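(* Let $(\Omega,\mathcal A)$ be a measurable space, let $U$ be an open set in $\mathbb C$, let $f:\Omega\times U\to\mathbb C$ be a random holomorphic function on $U$, and let $K$ be a compact subset of $U$. Then there exists a sequence $R_1,R_2,\ldots$ of random rational functions with poles off $K$ such that, for each $\omega\in\Omega$, $R_n(\omega,\cdot)\to f(\omega,\cdot)$ uniformly on $K$.
   Context: A random holomorphic function on an open set $U$ is a function $f:\Omega\times U\to\mathbb C$ such that $f(\omega,\cdot)$ is holomorphic on $U$ for every $\omega\in\Omega$ and $f(\cdot,z)$ is measurable (Borel sets on $\mathbb C$) for every $z\in U$. A random rational function with poles off $K$ is a function $R(\omega,z)$ such that $R(\omega,\cdot)$ is a rational function with no poles on $K$ for each $\omega$ and $R(\cdot,z)$ is measurable for each $z$. *)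

(* Defs.v *)
From HB Require Import structures.
From mathcomp Require Import all_boot all_order all_algebra.
From mathcomp Require Import all_classical all_reals all_analysis.
From mathcomp.real_closed Require Import complex.
Import numFieldNormedType.Exports.
Import Order.TTheory GRing.Theory Num.Theory.

Set Implicit Arguments.
Unset Strict Implicit.
Unset Printing Implicit Defensive.

Local Open Scope ring_scope.
Local Open Scope classical_set_scope.

(* The complex plane, built as R[i] over a real type R, viewed as a
   numClosedFieldType so that MathComp-Analysis equips it with its
   (norm) topology and its structure of normed space over itself. *)
Definition CC (R : realType) : numClosedFieldType := R[i].

Definition borelC (R : realType) : set (set (CC R)) :=
  <<s [set A : set (CC R) | open A] >>.

Definition measurable_C (d : measure_display) (T : measurableType d)
  (R : realType) (g : T -> CC R) : Prop :=
  forall B : set (CC R), borelC B -> measurable (g @^-1` B).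

Definition holomorphic_on (R : realType) (U : set (CC R)) (h : CC R -> CC R)
  : Prop :=
  forall z, U z -> derivable h z 1.

Definition random_holomorphic (d : measure_display) (T : measurableType d)
  (R : realType) (U : set (CC R)) (f : T -> CC R -> CC R) : Prop :=
  (forall w : T, holomorphic_on U (f w)) /\
  (forall z : CC R, U z -> measurable_C (fun w => f w z)).

(* h is a rational function with no poles on K: h = p/q with p, q coprime
   polynomials, q <> 0 and q has no zero on K.  (At the poles of h, i.e. the
   zeros of q, which all lie off K, the value is p.[z]/0 = 0 by MathComp's
   convention x/0 = 0.) *)
Definition rational_poles_off (R : realType) (K : set (CC R))
  (h : CC R -> CC R) : Prop :=
  exists p q : {poly CC R},
    [/\ q != 0, coprimep p q, (forall z, K z -> ~~ root q z)
      & forall z, h z = p.[z] / q.[z]].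

Definition random_rational (d : measure_display) (T : measurableType d)
  (R : realType) (K : set (CC R)) (Rf : T -> CC R -> CC R) : Prop :=
  (forall w : T, rational_poles_off K (Rf w)) /\
  (forall z : CC R, measurable_C (fun w => Rf w z)).

Definition unif_cvg_on (R : realType) (K : set (CC R))
  (g : nat -> CC R -> CC R) (h : CC R -> CC R) : Prop :=
  forall e : CC R, 0 < e ->
    exists N : nat, forall n : nat, (N <= n)%N ->
      forall z, K z -> `|g n z - h z| < e.

(* Main.v *)
Require Import Defs.
From HB Require Import structures.
From mathcomp Require Import all_boot all_order all_algebra.
From mathcomp Require Import all_classical all_reals all_analysis.
From mathcomp.real_closed Require Import complex.
From mathcomp Require Import ring lra zify.
Import numFieldNormedType.Exports.
Import Order.TTheory GRing.Theory Num.Theory.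
Local Open Scope ring_scope.
Local Open Scope classical_set_scope.

Set Implicit Arguments.
Unset Strict Implicit.
Unset Printing Implicit Defensive.

(* Runge's theorem by quadrature: approximate the Cauchy integral over a grid
   contour around K by midpoint sums.  Nodes and weights depend on U and K
   only, so each approximant is a fixed linear combination of the f(., x_j),
   hence measurable.  Integrals are never formed: midpoint sums are exactly
   additive under bisection of squares and vanish on affine functions, so
   Goursat's argument shows directly that the sums over the boundary of a square
   tend to 0.  The sums of 1/(w - z) are not computed either: up to a null
   sequence they do not depend on z (enlarge the contour), and they stay away
   from 0, so one divides by them.  Finally the residues are perturbed to be
   nonzero, which keeps every fraction reduced. *)

(** The obstacle is measurability in ω: approximating each f(ω,.) on its own involves choices that
    depend on ω. So the nodes and weights must serve all functions holomorphic on U at once; only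
    the rate of convergence may depend on the function, because the conclusion asks for no
    uniformity in ω. Cauchy's formula is replaced by the splitting f(w)/(w - z) = (f(w) - f(z))/(w -
    z) + f(z)/(w - z). The first term is bounded near z but need not be differentiable at z, whence
    a Goursat theorem with one exceptional point. The second leaves f(z) times a sum whose
    substitute, the same for all z in K, is the sum of 1/w around one large square centred at 0.
    This yields convergence for each z separately. It becomes uniform on K because the contour keeps
    a positive distance from K, which makes the sums Lipschitz in z with a constant independent of
    the number of nodes. *)

(** * Complex numbers in real coordinates *)

Section ComplexCoordinates.
Variable R : realType.
Implicit Types (z w p v : CC R) (x y h e : R).

Definition cx x y : CC R := Complex x y.
Definition re z : R := complex.Re z.
Definition im z : R := complex.Im z.
(** The library norm of a complex number is itself complex, with imaginary part 0. Its real part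
    lives in an ordered field, where estimates are within reach of [lra]. *)
Definition nrm z : R := re `|z|.

Lemma eqC z w : re z = re w -> im z = im w -> z = w.
Proof. by case: z => a b; case: w => c d; rewrite /re /im /= => -> ->. Qed.
Lemma re_cx x y : re (cx x y) = x. Proof. by []. Qed.
Lemma im_cx x y : im (cx x y) = y. Proof. by []. Qed.
Lemma re0 : re 0 = 0. Proof. by []. Qed.
Lemma im0 : im 0 = 0. Proof. by []. Qed.
Lemma re1 : re 1 = 1. Proof. by []. Qed.
Lemma im1 : im 1 = 0. Proof. by []. Qed.
Lemma reD z w : re (z + w) = re z + re w. Proof. by case: z => a b; case: w. Qed.
Lemma imD z w : im (z + w) = im z + im w. Proof. by case: z => a b; case: w. Qed.
Lemma reN z : re (- z) = - re z. Proof. by case: z. Qed.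
Lemma imN z : im (- z) = - im z. Proof. by case: z. Qed.
Lemma reM z w : re (z * w) = re z * re w - im z * im w.
Proof. by case: z => a b; case: w. Qed.
Lemma imM z w : im (z * w) = re z * im w + im z * re w.
Proof. by case: z => a b; case: w. Qed.
Definition reimE := (re_cx, im_cx, re0, im0, re1, im1, reD, imD, reN, imN, reM, imM).

Lemma cxD x y x' y' : cx x y + cx x' y' = cx (x + x') (y + y'). Proof. by []. Qed.
Lemma half_cx : 2^-1 = cx 2^-1 0 :> CC R.
Proof.
apply: (mulfI (_ : 2 != 0)); first by rewrite pnatr_eq0.
by rewrite mulfV ?pnatr_eq0//; apply: eqC; rewrite !reimE; field.
Qed.

Lemma normE z : `|z| = cx (nrm z) 0. Proof. by []. Qed.
Lemma nrmE z : nrm z = Num.sqrt (re z ^+ 2 + im z ^+ 2). Proof. by case: z. Qed.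
Lemma leC x y : (cx x 0 <= cx y 0) = (x <= y). Proof. exact: lecR. Qed.
Lemma ltC x y : (cx x 0 < cx y 0) = (x < y). Proof. exact: ltcR. Qed.
Lemma norm_leC z x : (`|z| <= cx x 0) = (nrm z <= x). Proof. by rewrite normE leC. Qed.
Lemma norm_ltC z x : (`|z| < cx x 0) = (nrm z < x). Proof. by rewrite normE ltC. Qed.
Lemma gt0C (e : CC R) : 0 < e -> e = cx (re e) 0 /\ 0 < re e.
Proof. by case: e => a b; rewrite ltcE/= => /andP[/eqP-> a0]. Qed.
Lemma nrmM z w : nrm (z * w) = nrm z * nrm w.
Proof. by rewrite /nrm normrM reM [im `|z|]/= mul0r subr0. Qed.
Lemma nrmD z w : nrm (z + w) <= nrm z + nrm w.
Proof. by rewrite -norm_leC (le_trans (ler_normD z w))// !normE lecE /= addr0 eqxx lexx. Qed.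
Lemma nrmN z : nrm (- z) = nrm z. Proof. by rewrite /nrm normrN. Qed.
Lemma nrmB z w : nrm (z - w) = nrm (w - z). Proof. by rewrite -nrmN opprB. Qed.
Lemma nrm0 : nrm 0 = 0. Proof. by rewrite /nrm normr0. Qed.
Lemma nrm1 : nrm 1 = 1. Proof. by rewrite /nrm normr1. Qed.
Lemma nrm_ge0 z : 0 <= nrm z. Proof. by rewrite nrmE sqrtr_ge0. Qed.
Lemma nrm_eq0 z : (nrm z == 0) = (z == 0).
Proof.
apply/eqP/eqP => [h|->]; last exact: nrm0.
by apply/eqP; rewrite -normr_eq0 normE h.
Qed.
Lemma nrm_gt0 z : (0 < nrm z) = (z != 0).
Proof. by rewrite lt_neqAle nrm_ge0 andbT eq_sym nrm_eq0. Qed.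
Lemma nrmV z : nrm z^-1 = (nrm z)^-1.
Proof.
have [->|z0] := eqVneq z 0; first by rewrite invr0 nrm0 invr0.
have n0 : nrm z != 0 by rewrite nrm_eq0.
by apply: (mulfI n0); rewrite -nrmM !mulfV// nrm1.
Qed.
Lemma re_le_nrm z : `|re z| <= nrm z.
Proof. by rewrite nrmE -sqrtr_sqr ler_sqrt ?addr_ge0 ?sqr_ge0// lerDl sqr_ge0. Qed.
Lemma im_le_nrm z : `|im z| <= nrm z.
Proof. by rewrite nrmE -sqrtr_sqr ler_sqrt ?addr_ge0 ?sqr_ge0// lerDr sqr_ge0. Qed.
Lemma nrm_cx0 x : nrm (cx x 0) = `|x|.
Proof. by rewrite nrmE !reimE expr0n addr0 sqrtr_sqr. Qed.
Lemma nrm_0cx y : nrm (cx 0 y) = `|y|.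
Proof. by rewrite nrmE !reimE expr0n add0r sqrtr_sqr. Qed.
Lemma nrm_le_reim z : nrm z <= `|re z| + `|im z|.
Proof.
rewrite {1}(_ : z = cx (re z) 0 + cx 0 (im z)).
  by apply: le_trans (nrmD _ _) _; rewrite nrm_cx0 nrm_0cx.
by apply: eqC; rewrite !reimE; ring.
Qed.
Lemma nrm_half : nrm 2^-1 = 2^-1.
Proof. by rewrite half_cx nrm_cx0 ger0_norm// invr_ge0. Qed.
Lemma nrm_triangle w z p : nrm (z - p) <= nrm (z - w) + nrm (w - p).
Proof. by rewrite -[z - p](subrKA w); exact: nrmD. Qed.

(** Differentiability with the quotient multiplied out, so that the estimate also holds at w = z. *)
Lemma derivable_eps (g : CC R -> CC R) z : derivable g z 1 ->
  exists d : CC R, forall e, 0 < e -> exists2 r, 0 < r &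
    forall w, nrm (w - z) < r -> nrm (g w - g z - d * (w - z)) <= e * nrm (w - z).
Proof.
rewrite /derivable => /cvg_ex[d Hd]; exists d => e e0.
move/cvgrPdist_le: Hd => /(_ (cx e 0)); rewrite ltC => /(_ e0).
move=> /nbhs_ballP[r /gt0C[-> r0] Hr]; exists (re r) => // w wz.
have [->|wNz] := eqVneq w z; first by rewrite !subrr mulr0 subrr nrm0 mulr0.
have hz : w - z != 0 by rewrite subr_eq0.
have := Hr (w - z); rewrite /ball/= sub0r normrN norm_ltC => /(_ wz hz).
rewrite /= norm_leC /GRing.scale/= mulr1 subrK => le_e.
rewrite -nrmN (_ : - _ = (d - (w - z)^-1 * (g w - g z)) * (w - z)).
  by rewrite nrmM ler_wpM2r// nrm_ge0.
by rewrite mulrBl mulrAC mulVf// mul1r opprB.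
Qed.

Lemma open_eps (A : set (CC R)) z : open A -> A z ->
  exists2 r, 0 < r & forall w, nrm (w - z) < r -> A w.
Proof.
move=> oA Az; have /nbhs_ballP[r /gt0C[-> r0] Hr] := open_nbhs_nbhs (conj oA Az).
by exists (re r) => // w wz; apply: Hr; rewrite /ball/= distrC norm_ltC.
Qed.

Lemma nrm_continuous : continuous (nrm : CC R -> R).
Proof.
move=> z; apply/(@cvgrPdist_le _ _ _ (nbhs z)) => e e0.
have e0' : 0 < cx e 0 by rewrite ltC.
apply: filterS (nbhsx_ballx z _ e0') => w; rewrite /ball/= norm_ltC => /ltW wz; apply: le_trans wz.
rewrite ler_norml; apply/andP; split.
  by have := nrm_triangle z w 0; rewrite !subr0 nrmB; lra.
by have := nrm_triangle w z 0; rewrite !subr0; lra.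
Qed.

Lemma compact_nrm_bounded (K : set (CC R)) : compact K ->
  exists M, forall z, K z -> nrm z <= M.
Proof.
move=> cK; have cnK : compact (nrm @` K).
  by apply: continuous_compact => //; apply: continuous_subspaceT => z; exact: nrm_continuous.
have [M _ HM] := pinfty_ex_gt0 (compact_bounded cnK).
exists M => z Kz; apply: le_trans (ler_norm _) _.
by apply: HM; exists z.
Qed.

Lemma compact_compl_eps (K : set (CC R)) z : compact K -> ~ K z ->
  exists2 r, 0 < r & forall w, nrm (w - z) < r -> ~ K w.
Proof.
move=> cK Kz; apply: (@open_eps (~` K)) => //; apply: closed_openC.
by apply: compact_closed => //; exact: norm_hausdorff.
Qed.

End ComplexCoordinates.

(** * Bisection of squares and midpoint sums *)

Section Squares.
Variable R : realType.
Implicit Types (z w p v c : CC R) (x y h e : R).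

Definition square p h : set (CC R) :=
  [set w | (re p <= re w <= re p + h) && (im p <= im w <= im p + h)].

Lemma nested_intervals (u v : nat -> R) : (forall n, u n <= u n.+1) ->
  (forall n, v n.+1 <= v n) -> (forall n, u n <= v n) ->
  exists l, forall n, u n <= l <= v n.
Proof.
move=> u_incr v_decr uv.
have uh m n : (m <= n)%N -> u m <= u n.
  by move=> /subnK <-; elim: (n - m)%N => // k; rewrite addSn => /le_trans; apply.
have vh m n : (m <= n)%N -> v n <= v m.
  by move=> /subnK <-; elim: (n - m)%N => // k; rewrite addSn; exact: le_trans.
have uvmn m n : u m <= v n.
  apply: le_trans (uh _ _ (leq_maxl m n)) _.
  exact: le_trans (uv _) (vh _ _ (leq_maxr m n)).
exists (sup (range u)) => n; apply/andP; split.
  by apply: ub_le_sup; [exists (v 0%N) => _ [m _ <-]|exists n].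
by apply: ge_sup; [exists (u 0%N); exists 0%N|move=> _ [m _ <-]].
Qed.

Lemma exp2_gt x y : 0 < y -> exists n, x / 2 ^+ n < y.
Proof.
move=> y0; exists (Num.bound (x / y)).
by rewrite ltr_pdivrMr ?exprn_gt0// mulrC -ltr_pdivrMr// upper_nthrootP.
Qed.

(* The compactness principle behind every local-to-global step: repeatedly
   halving a square on which P fails produces nested squares shrinking to a
   point, near which P fails. *)
Lemma cousin (P : CC R -> R -> Prop) p0 h0 :
  (forall p h, 0 < h -> P p h -> P (p + cx h 0) h -> P (p + cx 0 h) h ->
     P (p + cx h h) h -> P p (h + h)) ->
  (forall c, square p0 h0 c -> exists2 r, 0 < r &
     forall p h, 0 < h < r -> square p h c -> P p h) ->
  0 < h0 -> P p0 h0.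
Proof.
move=> Psplit Ploc h0_gt0; apply: contrapT => nP0.
pose bad (s : CC R * R) := 0 < s.2 /\ ~ P s.1 s.2.
pose child (s t : CC R * R) := [/\ t.2 = s.2 / 2,
  re s.1 <= re t.1 <= re s.1 + s.2 / 2 & im s.1 <= im t.1 <= im s.1 + s.2 / 2].
have bad_child (s : {s | bad s}) : exists t : {s | bad s}, child (sval s) (sval t).
  case: s => -[p h] [/= h_gt0 nP]; apply: contrapT => /forallNP nochild.
  have h2_gt0 : 0 < h / 2 by rewrite divr_gt0.
  have good q : re p <= re q <= re p + h / 2 -> im p <= im q <= im p + h / 2 ->
      P q (h / 2).
    move=> qr qi; apply: contrapT => nPq.
    by apply: (nochild (exist _ (q, h / 2) (conj h2_gt0 nPq))).
  apply: nP; rewrite [h](splitr h).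
  by apply: Psplit => //; apply: good; rewrite ?reimE; lra.
have [F HF] := choice bad_child.
pose s n := sval (iter n F (exist bad (p0, h0) (conj h0_gt0 nP0))).
have sP n : bad (s n) by rewrite /s; case: (iter _ _ _).
have sS n : child (s n) (s n.+1) by rewrite /s iterS; exact: HF.
have s2 n : (s n).2 = h0 / 2 ^+ n.
  elim: n => [|n IHn]; first by rewrite expr0 divr1.
  by have [-> _ _] := sS n; rewrite IHn exprSr invfM mulrA.
have s2_gt0 n : 0 < (s n).2 by have [] := sP n.
have [cr Hr] : exists l, forall n, re (s n).1 <= l <= re (s n).1 + (s n).2.
  apply: nested_intervals => n; have [h2 /andP[? ?] _] := sS n => //; first lra.
  by have := s2_gt0 n; lra.
have [ci Hi] : exists l, forall n, im (s n).1 <= l <= im (s n).1 + (s n).2.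
  apply: nested_intervals => n; have [h2 _ /andP[? ?]] := sS n => //; first lra.
  by have := s2_gt0 n; lra.
have sc n : square (s n).1 (s n).2 (cx cr ci) by rewrite /square/= Hr Hi.
have [r r_gt0 Hloc] := Ploc _ (sc 0%N).
have [n Hn] := exp2_gt h0 r_gt0; have [_] := sP n; apply.
by apply: Hloc => //; rewrite s2_gt0/= s2.
Qed.

Lemma square_nrm p h w : square p h w -> nrm (w - p) <= 2 * h.
Proof.
move=> /andP[/andP[? ?] /andP[? ?]]; apply: le_trans (nrm_le_reim _) _.
by rewrite !reimE !ger0_norm; lra.
Qed.

Lemma square_diam p h c w : square p h c -> square p h w -> nrm (w - c) <= 2 * h.
Proof.
move=> /andP[/andP[? ?] /andP[? ?]] /andP[/andP[? ?] /andP[? ?]].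
apply: le_trans (nrm_le_reim _) _; rewrite !reimE mulrDl mul1r.
by apply: lerD; rewrite ler_norml; lra.
Qed.

(** Midpoint rule with 2^n nodes for the integral of g from p to p + v. The recursion by halving
    makes additivity under bisection hold by computation. *)
Fixpoint edge_sum n (g : CC R -> CC R) p v : CC R :=
  if n is n'.+1 then edge_sum n' g p (v / 2) + edge_sum n' g (p + v / 2) (v / 2)
  else v * g (p + v / 2).

(** The counterclockwise contour. The top and left edges are written in the direction of increasing
    coordinate and subtracted, so that an edge shared by two squares is literally the same
    [edge_sum] and cancels by [ring]. *)
Definition square_sum n g p h : CC R :=
  edge_sum n g p (cx h 0) + edge_sum n g (p + cx h 0) (cx 0 h)
  - edge_sum n g (p + cx 0 h) (cx h 0) - edge_sum n g p (cx 0 h).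

Definition segment p v : set (CC R) :=
  [set w | exists2 t : R, 0 <= t <= 1 & w = p + v * cx t 0].

Lemma segment_mid p v : segment p v (p + v / 2).
Proof. by exists 2^-1; [lra|rewrite half_cx]. Qed.
Lemma segment_l p v : segment p (v / 2) `<=` segment p v.
Proof.
move=> _ [t ? ->]; exists (t / 2); first by lra.
by rewrite half_cx; apply: eqC; rewrite !reimE; ring.
Qed.
Lemma segment_r p v : segment (p + v / 2) (v / 2) `<=` segment p v.
Proof.
move=> _ [t ? ->]; exists ((1 + t) / 2); first by lra.
by rewrite half_cx; apply: eqC; rewrite !reimE; field.
Qed.

Lemma eq_edge_sum n (g1 g2 : CC R -> CC R) p v : (forall w, segment p v w -> g1 w = g2 w) ->
  edge_sum n g1 p v = edge_sum n g2 p v.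
Proof.
elim: n p v => [|n IHn] p v eg /=; first by rewrite eg//; exact: segment_mid.
by congr (_ + _); apply: IHn => w /= ?; apply: eg; [exact: segment_l|exact: segment_r].
Qed.

Lemma edge_sumD n (g1 g2 : CC R -> CC R) p v :
  edge_sum n (fun w => g1 w + g2 w) p v = edge_sum n g1 p v + edge_sum n g2 p v.
Proof. by elim: n p v => [|n IHn] p v /=; [rewrite mulrDr|rewrite !IHn addrACA]. Qed.

Lemma edge_sumZ n a (g : CC R -> CC R) p v :
  edge_sum n (fun w => a * g w) p v = a * edge_sum n g p v.
Proof. by elim: n p v => [|n IHn] p v /=; [rewrite mulrCA|rewrite !IHn mulrDr]. Qed.

(** The midpoint rule is exact on affine functions, at every level n and not just in the limit. *)
Lemma edge_sum_affine n a b p v :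
  edge_sum n (fun w => a + b * w) p v = v * (a + b * (p + v / 2)).
Proof.
elim: n p v => [|n IHn] p v //=; rewrite !IHn half_cx.
by apply: eqC; rewrite !reimE; field.
Qed.

Lemma edge_sum_le n (g : CC R -> CC R) p v e :
  (forall w, segment p v w -> nrm (g w) <= e) -> nrm (edge_sum n g p v) <= nrm v * e.
Proof.
elim: n p v => [|n IHn] p v ge /=.
  by rewrite nrmM ler_wpM2l ?nrm_ge0//; apply: ge; exact: segment_mid.
apply: le_trans (nrmD _ _) _.
have -> : nrm v * e = nrm (v / 2) * e + nrm (v / 2) * e.
  by rewrite nrmM nrm_half; field.
apply: lerD; apply: IHn => w ?; apply: ge; [exact: segment_l|exact: segment_r].
Qed.

Lemma im_edge_sum_ge n (g : CC R -> CC R) p v e :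
  (forall w, segment p v w -> e <= im (v * g w)) -> e <= im (edge_sum n g p v).
Proof.
elim: n p v e => [|n IHn] p v e ge /=; first by apply: ge; exact: segment_mid.
rewrite imD [e]splitr; apply: lerD; apply: IHn => w sw.
  have := ge _ (segment_l sw); rewrite half_cx !reimE; lra.
have := ge _ (segment_r sw); rewrite half_cx !reimE; lra.
Qed.

(** The level drops by one as the side is halved, so both members use the same nodes on the outer
    edges; the inner edges cancel. *)
Lemma square_sum_split n g p h : square_sum n.+1 g p (h + h) =
  square_sum n g p h + square_sum n g (p + cx h 0) h +
  square_sum n g (p + cx 0 h) h + square_sum n g (p + cx h h) h.
Proof.
rewrite /square_sum /=.
have -> : cx (h + h) 0 / 2 = cx h 0.
  by rewrite half_cx; apply: eqC; rewrite !reimE; field.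
have -> : cx 0 (h + h) / 2 = cx 0 h.
  by rewrite half_cx; apply: eqC; rewrite !reimE; field.
rewrite -!(addrA p) !cxD !(addr0,add0r); ring.
Qed.
End Squares.

(** * Goursat's theorem with an exceptional point *)

Section Goursat.
Variable R : realType.
Implicit Types (z w p v c : CC R) (x y h e : R) (g : CC R -> CC R).

Lemma cvgC0P (u : nat -> CC R) : u @ \oo --> (0 : CC R) <->
  forall e, 0 < e -> exists N, forall n, (N <= n)%N -> nrm (u n) <= e.
Proof.
split=> [/(@cvgrPdist_le _ _ _ \oo) u0 e e0|u0].
  have e0' : 0 < cx e 0 by rewrite ltC.
  have [N _ HN] := u0 _ e0'; exists N => n /HN /=.
  by rewrite sub0r normrN norm_leC.
apply/(@cvgrPdist_le _ _ _ \oo) => e /gt0C[-> /u0[N HN]].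
by exists N => // n /HN; rewrite /= sub0r normrN norm_leC.
Qed.

Definition square_boundary p h : set (CC R) := [set w | square p h w /\
  [\/ re w = re p, re w = re p + h, im w = im p | im w = im p + h]].

Lemma segment_bottom p h : 0 <= h -> segment p (cx h 0) `<=` square_boundary p h.
Proof.
move=> h0 _ [t /andP[t0 t1] ->]; rewrite /square_boundary /square /= !reimE.
split; last by apply: Or43; ring.
by have := ler_wpM2l h0 t1; have := mulr_ge0 h0 t0; lra.
Qed.
Lemma segment_top p h : 0 <= h ->
  segment (p + cx 0 h) (cx h 0) `<=` square_boundary p h.
Proof.
move=> h0 _ [t /andP[t0 t1] ->]; rewrite /square_boundary /square /= !reimE.
split; last by apply: Or44; ring.
by have := ler_wpM2l h0 t1; have := mulr_ge0 h0 t0; lra.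
Qed.
Lemma segment_left p h : 0 <= h -> segment p (cx 0 h) `<=` square_boundary p h.
Proof.
move=> h0 _ [t /andP[t0 t1] ->]; rewrite /square_boundary /square /= !reimE.
split; last by apply: Or41; ring.
by have := ler_wpM2l h0 t1; have := mulr_ge0 h0 t0; lra.
Qed.
Lemma segment_right p h : 0 <= h ->
  segment (p + cx h 0) (cx 0 h) `<=` square_boundary p h.
Proof.
move=> h0 _ [t /andP[t0 t1] ->]; rewrite /square_boundary /square /= !reimE.
split; last by apply: Or42; ring.
by have := ler_wpM2l h0 t1; have := mulr_ge0 h0 t0; lra.
Qed.

Lemma square_sum_le n g p h e : 0 <= h ->
  (forall w, square_boundary p h w -> nrm (g w) <= e) ->
  nrm (square_sum n g p h) <= 4 * h * e.
Proof.
move=> h0 ge.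
have hb : nrm (edge_sum n g p (cx h 0)) <= h * e.
  rewrite -{2}(ger0_norm h0) -nrm_cx0; apply: edge_sum_le => w /(segment_bottom h0).
  exact: ge.
have ht : nrm (edge_sum n g (p + cx 0 h) (cx h 0)) <= h * e.
  rewrite -{3}(ger0_norm h0) -nrm_cx0; apply: edge_sum_le => w /(segment_top h0).
  exact: ge.
have hl : nrm (edge_sum n g p (cx 0 h)) <= h * e.
  rewrite -{2}(ger0_norm h0) -nrm_0cx; apply: edge_sum_le => w /(segment_left h0).
  exact: ge.
have hr : nrm (edge_sum n g (p + cx h 0) (cx 0 h)) <= h * e.
  rewrite -{3}(ger0_norm h0) -nrm_0cx; apply: edge_sum_le => w /(segment_right h0).
  exact: ge.
rewrite /square_sum; apply: le_trans (nrmD _ _) _; rewrite nrmN.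
have := nrmD (edge_sum n g p (cx h 0) + edge_sum n g (p + cx h 0) (cx 0 h))
  (- edge_sum n g (p + cx 0 h) (cx h 0)).
have := nrmD (edge_sum n g p (cx h 0)) (edge_sum n g (p + cx h 0) (cx 0 h)).
rewrite nrmN; lra.
Qed.

Lemma eq_square_sum n g1 g2 p h : g1 =1 g2 -> square_sum n g1 p h = square_sum n g2 p h.
Proof. by move=> eg; rewrite /square_sum; do !congr (_ + _); rewrite ?(@eq_edge_sum _ n g1 g2). Qed.

Lemma square_sumD n g1 g2 p h : square_sum n (fun w => g1 w + g2 w) p h =
  square_sum n g1 p h + square_sum n g2 p h.
Proof. by rewrite /square_sum !edge_sumD; ring. Qed.

Lemma square_sumZ n a g p h :
  square_sum n (fun w => a * g w) p h = a * square_sum n g p h.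
Proof. by rewrite /square_sum !edge_sumZ; ring. Qed.

Lemma square_sum_affine n a b p h : square_sum n (fun w => a + b * w) p h = 0.
Proof.
by rewrite /square_sum !edge_sum_affine half_cx; apply: eqC; rewrite !reimE; field.
Qed.

(* The sum of the two half-open indicators is additive under bisection, yet at
   least 1 on every closed interval containing x: it charges the squares around
   an exceptional point without counting how many of them touch it. *)
Definition incidence x y h : R := (y <= x < y + h)%R%:R + (y < x <= y + h)%R%:R.

Lemma incidence_ge0 x y h : 0 <= incidence x y h.
Proof. by rewrite /incidence addr_ge0. Qed.

Lemma incidence_split x y h : 0 < h ->
  incidence x y (h + h) = incidence x y h + incidence x (y + h) h.
Proof.
move=> h0; rewrite /incidence.
have : y + (h + h) = y + h + h by rewrite addrA.
move: (y + (h + h)) => b ->.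
case: (ltgtP y x) => ?; case: (ltgtP x (y + h)) => ?; case: (ltgtP x (y + h + h)) => ? //=;
  rewrite ?(addr0,add0r)//; lra.
Qed.

Lemma incidence_ge1 x y h : 0 < h -> y <= x <= y + h -> 1 <= incidence x y h.
Proof.
move=> h0 /andP[yx xh]; rewrite /incidence yx xh andbT /=.
case: (ltgtP y x) => [?|?|e]; [by rewrite lerDr|lra|].
by rewrite e ltrDl h0 addr0.
Qed.

(** The first-order Taylor polynomial at c has sum exactly 0. The remainder is at most (e/8) * 2h on
    a contour of length 4h, whence e / 8. *)
Lemma square_sum_derivable_le g c e : derivable g c 1 -> 0 < e ->
  exists2 r, 0 < r & forall p h n, 0 < h < r -> square p h c ->
    nrm (square_sum n g p h) <= e * (h * h).
Proof.
move=> /derivable_eps[d Hd] e0; have e8 : 0 < e / 8 by rewrite divr_gt0.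
have [r r0 Hr] := Hd _ e8; exists (r / 2); first by rewrite divr_gt0.
move=> p h n /andP[h0 hr] pc.
rewrite (@eq_square_sum n g (fun w => (g w - g c - d * (w - c)) +
  (g c - d * c + d * w))); last by move=> w; ring.
rewrite square_sumD square_sum_affine addr0.
rewrite (_ : e * (h * h) = 4 * h * (e / 8 * (2 * h))); last by field.
apply: square_sum_le => [|w [pw _]]; first exact: ltW.
have wc := square_diam pc pw.
by apply: le_trans (Hr _ _) _; [lra|rewrite ler_wpM2l// ltW].
Qed.

(** The bound d * [mu] is additive under bisection, so [cousin] reduces it to small squares. The
    area part of [mu] pays for points of differentiability, the incidence part for z, where
    boundedness suffices: this is how difference quotients enter. *)
Lemma goursat g z p h : 0 < h ->
  (forall c, square p h c -> c != z -> derivable g c 1) ->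
  (square p h z -> exists M r : R, 0 < r /\ forall w, nrm (w - z) < r -> nrm (g w) <= M) ->
  square_sum n g p h @[n --> \oo] --> (0 : CC R).
Proof.
move=> h0 dg bg; apply/cvgC0P => e e0.
pose mu q k := k * k + incidence (re z) (re q) k * incidence (im z) (im q) k.
have mu_ge0 q k : 0 <= mu q k by rewrite /mu addr_ge0//; [rewrite -expr2 sqr_ge0|rewrite mulr_ge0 ?incidence_ge0].
pose d := e / (mu p h + 1).
have d0 : 0 < d by rewrite divr_gt0// ltr_wpDl.
suff [N HN] : exists N, forall n, (N <= n)%N -> nrm (square_sum n g p h) <= d * mu p h.
  exists N => n /HN /le_trans; apply.
  by rewrite /d mulrAC ler_pdivrMr ?ltr_wpDl// ler_wpM2l ?ltW//; lra.
apply: (@cousin _ (fun q k => exists N, forall n, (N <= n)%N ->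
  nrm (square_sum n g q k) <= d * mu q k)) => //.
- move=> q k k0 [N1 H1] [N2 H2] [N3 H3] [N4 H4].
  (* The successor pays for the level lost in the bisection. *)
  exists (N1 + N2 + N3 + N4).+1 => -[//|n]; rewrite ltnS => nN.
  rewrite square_sum_split.
  have := nrmD (square_sum n g q k + square_sum n g (q + cx k 0) k +
    square_sum n g (q + cx 0 k) k) (square_sum n g (q + cx k k) k).
  have := nrmD (square_sum n g q k + square_sum n g (q + cx k 0) k)
    (square_sum n g (q + cx 0 k) k).
  have := nrmD (square_sum n g q k) (square_sum n g (q + cx k 0) k).
  have : d * mu q (k + k) = d * mu q k + d * mu (q + cx k 0) k +
     d * mu (q + cx 0 k) k + d * mu (q + cx k k) k.
    by rewrite /mu !reimE !addr0 !(incidence_split _ _ k0); ring.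
  have := H1 n (leq_trans _ nN); have := H2 n (leq_trans _ nN).
  have := H3 n (leq_trans _ nN); have := H4 n (leq_trans _ nN).
  have le1 : (N1 <= N1 + N2 + N3 + N4)%N by rewrite -!addnA leq_addr.
  have le2 : (N2 <= N1 + N2 + N3 + N4)%N by rewrite -!addnA addnCA leq_addr.
  have le3 : (N3 <= N1 + N2 + N3 + N4)%N by rewrite -addnA addnCA leq_addr.
  move=> /(_ (leq_addl _ _)) ? /(_ le3) ? /(_ le2) ? /(_ le1) ?.
  lra.
- move=> c pc; have [cz|cz] := eqVneq c z.
    subst c; have [M [r [r0 Hr]]] := bg pc.
    have M1 : 0 < `|M| + 1 by rewrite ltr_wpDl.
    (* The first bound puts a square of side k around z inside the ball of radius r. The second
       makes 4k(|M| + 1) at most d, hence at most d * [mu], since both incidences are at least 1. *)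
    exists (Num.min (r / 2) (d / (4 * (`|M| + 1)))).
      by rewrite lt_min divr_gt0//= (divr_gt0 d0)// mulr_gt0.
    move=> q k /andP[k0]; rewrite lt_min => /andP[kr kM] qz; exists 0%N => n _.
    have: nrm (square_sum n g q k) <= 4 * k * (`|M| + 1).
      apply: square_sum_le => [|w [qw _]]; first exact: ltW.
      have := square_diam qz qw => ?; apply: le_trans (Hr _ _) _; first by lra.
      by apply: le_trans (ler_norm _) _; lra.
    move=> /le_trans; apply; apply: (@le_trans _ _ (d * 1)).
      by move: kM; rewrite ltr_pdivlMr ?mulr_gt0//; lra.
    rewrite ler_wpM2l ?(ltW d0)// /mu.
    have /andP[i1 i2] := qz.
    have := incidence_ge1 k0 i1; have := incidence_ge1 k0 i2.
    set a := incidence (re z) _ _; set b := incidence (im z) _ _ => b1 a1.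
    have : 0 <= (a - 1) * (b - 1) by rewrite mulr_ge0// subr_ge0.
    have : 0 <= k * k by rewrite -expr2 sqr_ge0.
    lra.
  have [r r0 Hr] := square_sum_derivable_le (dg _ pc cz) d0.
  exists r => // q k kr qc; exists 0%N => n _; apply: le_trans (Hr _ _ _ kr qc) _.
  by rewrite ler_wpM2l ?(ltW d0)// lerDl mulr_ge0 ?incidence_ge0.
Qed.

End Goursat.

(** * Sums of 1/(w - z) around a square *)

Section Winding.
Variable R : realType.
Implicit Types (z w p v c : CC R) (x y h e : R) (g : CC R -> CC R).

Lemma derivable_subV z c : c != z -> derivable (fun w => (w - z)^-1) c 1.
Proof.
move=> cz; apply: (@derivableV _ _ (fun w => w - z)); first by rewrite subr_eq0.
by apply: derivableB; [exact: derivable_id|exact: derivable_cst].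
Qed.

Lemma square_sum_subV_cvg0 z p h : 0 < h -> ~ square p h z ->
  square_sum n (fun w => (w - z)^-1) p h @[n --> \oo] --> (0 : CC R).
Proof. by move=> h0 pz; apply: (goursat (z := z)) => // c _; exact: derivable_subV. Qed.

Definition open_square p h : set (CC R) :=
  [set w | (re p < re w < re p + h) && (im p < im w < im p + h)].

(* The difference g decays like |z - c| / |w|^2, so its sum over a square around
   z and c is small once the square is enlarged enough. *)
Lemma square_sum_enlarge z c p h : 0 < h -> open_square p h z -> open_square p h c ->
  let g w := (w - z)^-1 - (w - c)^-1 in
  forall e, 0 < e -> exists N, forall n, (N <= n)%N ->
    nrm (square_sum n g p h - square_sum n.+2 g (p - cx (2 * h) (2 * h)) (4 * h)) <= e.
Proof.
move=> h0 pz pc g e e0.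
have null q k : 0 < k -> ~ square q k z -> ~ square q k c ->
    exists N, forall n, (N <= n)%N -> nrm (square_sum n g q k) <= e / 6.
  move=> k0 qz qc.
  have e6 : 0 < e / 6 by rewrite divr_gt0.
  move: e6; move: (e / 6); apply/cvgC0P/(goursat (z := z)) => // w qw wz.
  apply: derivableB; apply: derivable_subV => //.
  by apply/eqP => wc; rewrite wc in qw.
have h2 : 0 < h + h by lra.
move: pz pc; rewrite /open_square /= => /andP[/andP[? ?] /andP[? ?]] /andP[/andP[? ?] /andP[? ?]].
(* The large square has four quarters of side 2h; the upper right one starts at p, and its own lower
   left quarter is the original square. The difference is thus made of three squares of side 2h and
   three of side h, none containing z or c: hence e / 6, and two levels. *)
pose q := p - cx (2 * h) (2 * h).
have [|||N1 H1] := null q (h + h) => //; try by rewrite /square /= /q !reimE; lra.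
have [|||N2 H2] := null (q + cx (h + h) 0) (h + h) => //; try by rewrite /square /= /q !reimE; lra.
have [|||N3 H3] := null (q + cx 0 (h + h)) (h + h) => //; try by rewrite /square /= /q !reimE; lra.
have [|||N4 H4] := null (p + cx h 0) h => //; try by rewrite /square /= /q !reimE; lra.
have [|||N5 H5] := null (p + cx 0 h) h => //; try by rewrite /square /= /q !reimE; lra.
have [|||N6 H6] := null (p + cx h h) h => //; try by rewrite /square /= /q !reimE; lra.
exists (N1 + N2 + N3 + N4 + N5 + N6)%N => n nN.
rewrite -/q (_ : 4 * h = (h + h) + (h + h)); last by ring.
rewrite square_sum_split (_ : q + cx (h + h) (h + h) = p); last first.
  by apply: eqC; rewrite /q !reimE; ring.
rewrite (square_sum_split n g p).
have {}H1 := H1 n.+1 (ltac:(clear -nN; lia)).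
have {}H2 := H2 n.+1 (ltac:(clear -nN; lia)).
have {}H3 := H3 n.+1 (ltac:(clear -nN; lia)).
have {}H4 := H4 n (ltac:(clear -nN; lia)).
have {}H5 := H5 n (ltac:(clear -nN; lia)).
have {}H6 := H6 n (ltac:(clear -nN; lia)).
move: H1 H2 H3 H4 H5 H6.
set s1 := square_sum n.+1 _ _ _; set s2 := square_sum n.+1 _ _ _; set s3 := square_sum n.+1 _ _ _.
set s4 := square_sum n _ _ _; set s5 := square_sum n _ _ _; set s6 := square_sum n _ _ _.
set s := square_sum n _ _ _ => H1 H2 H3 H4 H5 H6.
rewrite (_ : s - _ = - (s1 + s2 + s3 + s4 + s5 + s6)); last by ring.
rewrite nrmN.
have := nrmD (s1 + s2 + s3 + s4 + s5) s6.
have := nrmD (s1 + s2 + s3 + s4) s5.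
have := nrmD (s1 + s2 + s3) s4.
have := nrmD (s1 + s2) s3.
have := nrmD s1 s2.
lra.
Qed.

(** The difference of the inverses is (z - c)/((w - z)(w - c)). The small square is at distance at
    least h from the large contour, whose length is 16h. *)
Lemma square_sum_subV_far z c p h n : 0 < h -> open_square p h z -> open_square p h c ->
  nrm (square_sum n (fun w => (w - z)^-1 - (w - c)^-1)
         (p - cx (2 * h) (2 * h)) (4 * h)) <= 16 * nrm (z - c) / h.
Proof.
move=> h0 pz pc.
rewrite (_ : 16 * _ / _ = 4 * (4 * h) * (nrm (z - c) * (h^-1 * h^-1))); last first.
  by field; rewrite gt_eqF.
have far w z' : square_boundary (p - cx (2 * h) (2 * h)) (4 * h) w ->
    open_square p h z' -> nrm (w - z')^-1 <= h^-1 /\ w - z' != 0.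
  move=> [_ bw] /andP[/andP[? ?] /andP[? ?]].
  have hw : h <= nrm (w - z').
    have := re_le_nrm (w - z'); have := im_le_nrm (w - z').
    rewrite !ler_norml !reimE => /andP[? ?] /andP[? ?].
    by move: bw; rewrite !reimE => -[]; lra.
  have w0 : 0 < nrm (w - z') by exact: lt_le_trans hw.
  by rewrite -nrm_gt0 nrmV lef_pV2.
apply: square_sum_le => [|w bw]; first by rewrite mulr_ge0// ltW.
have [wz wz0] := far w z bw pz; have [wc wc0] := far w c bw pc.
rewrite (_ : _ - _ = (z - c) * ((w - z)^-1 * (w - c)^-1)); last first.
  by field; rewrite wz0 wc0.
by rewrite !nrmM ler_wpM2l ?nrm_ge0// ler_pM ?nrm_ge0.
Qed.

Lemma square_sum_subVB_cvg0 z c p h : 0 < h -> open_square p h z -> open_square p h c ->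
  square_sum n (fun w => (w - z)^-1 - (w - c)^-1) p h @[n --> \oo] --> (0 : CC R).
Proof.
set g := fun w => _.
(* Each enlargement multiplies h by 4, which gains more than the factor 2 claimed, and costs only an
   arbitrarily small error. *)
have claim m : forall p h, 0 < h -> open_square p h z -> open_square p h c ->
    forall e, 0 < e -> exists N, forall n, (N <= n)%N ->
      nrm (square_sum n g p h) <= 16 * nrm (z - c) / h / 2 ^+ m + e.
  elim: m => [|m IHm] {}p {}h h0 pz pc e e0.
    have [N HN] := square_sum_enlarge h0 pz pc e0.
    exists N => n /HN; rewrite -/g expr0 divr1 => le_e.
    have := square_sum_subV_far n.+2 h0 pz pc; rewrite -/g.
    set a := square_sum n g p h in le_e *; set b := square_sum n.+2 _ _ _ in le_e *.
    by have := nrmD (a - b) b; rewrite subrK; lra.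
  have e2 : 0 < e / 2 by rewrite divr_gt0.
  have [N HN] := square_sum_enlarge h0 pz pc e2.
  have [||| N' HN'] := IHm (p - cx (2 * h) (2 * h)) (4 * h) _ _ _ _ e2.
  - by rewrite mulr_gt0.
  - by move: pz => /andP[/andP[? ?] /andP[? ?]]; rewrite /open_square/= !reimE; lra.
  - by move: pc => /andP[/andP[? ?] /andP[? ?]]; rewrite /open_square/= !reimE; lra.
  exists (N + N')%N => n nN.
  have := HN n (ltac:(clear -nN; lia)); have := HN' n.+2 (ltac:(clear -nN; lia)); rewrite -/g.
  set a := square_sum n g p h; set b := square_sum n.+2 _ _ _.
  have -> : 16 * nrm (z - c) / (4 * h) / 2 ^+ m = (16 * nrm (z - c) / h / 2 ^+ m.+1) / 2.
    have hN0 : h != 0 by rewrite gt_eqF.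
    have mN0 : 2 ^+ m != 0 :> R by rewrite expf_neq0.
    by rewrite exprS; move: (2 ^+ m) mN0 => t t0; field; rewrite hN0 t0.
  have : 0 <= 16 * nrm (z - c) / h / 2 ^+ m.+1.
    by rewrite divr_ge0 ?exprn_ge0// divr_ge0 ?(ltW h0)// mulr_ge0 ?nrm_ge0.
  by have := nrmD (a - b) b; rewrite subrK; lra.
move=> h0 pz pc; apply/cvgC0P => e e0; have e2 : 0 < e / 2 by rewrite divr_gt0.
have [m Hm] := exp2_gt (16 * nrm (z - c) / h) e2.
have [N HN] := claim m p h h0 pz pc _ e2.
by exists N => n /HN /le_trans; apply; lra.
Qed.

Lemma im_divE u v : im (u / v) =
  (im u * re v - re u * im v) / (re v ^+ 2 + im v ^+ 2).
Proof.
have -> : v^-1 = cx (re v / (re v ^+ 2 + im v ^+ 2)) (- im v / (re v ^+ 2 + im v ^+ 2)).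
  by case: v => a b; apply: eqC; rewrite /re /im //= mulNr.
by rewrite !reimE; ring.
Qed.

(** On each edge, with its orientation, Im(v/(w - c)) is at least (h^2/2)/(h^2/2) = 1 at every
    point, as the distance to the centre is at most half the diagonal. This gives 1 per edge at
    every level, against π/2 for the integral. *)
Lemma im_square_sum_center n c h : 0 < h ->
  4 <= im (square_sum n (fun w => (w - c)^-1) (c - cx (h / 2) (h / 2)) h).
Proof.
move=> h0; have h2 : 0 < h ^+ 2 by rewrite exprn_gt0.
set p := c - _; set g := fun w => _.
have quad t : 0 <= t <= 1 -> (t - 1 / 2) ^+ 2 * h ^+ 2 <= h ^+ 2 / 4.
  move=> /andP[t0 t1]; rewrite mulrC ler_wpM2l ?(ltW h2)//.
  have : 0 <= t * (1 - t) by rewrite mulr_ge0// subr_ge0.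
  lra.
(* The sign is moved into the integrand so that the lower bound [im_edge_sum_ge] also applies to the
   subtracted edges. *)
have NE q v : - edge_sum n g q v = edge_sum n (fun w => -1 * g w) q v.
  by rewrite edge_sumZ mulN1r.
rewrite /square_sum !NE !imD.
suff [H1 H2 H3 H4] : [/\ 1 <= im (edge_sum n g p (cx h 0)),
    1 <= im (edge_sum n g (p + cx h 0) (cx 0 h)),
    1 <= im (edge_sum n (fun w => -1 * g w) (p + cx 0 h) (cx h 0)) &
    1 <= im (edge_sum n (fun w => -1 * g w) p (cx 0 h))] by lra.
split; apply: im_edge_sum_ge => _ [t /quad qt ->]; rewrite ?(mulrA _ (-1)) im_divE /p !reimE;
  (rewrite ler_pdivlMr; [by move: qt h2; nra|by move: qt h2; nra]).
Qed.
End Winding.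

(** * Weighted sums over a grid and their dependence on g and z *)

Section Grid.
Variable R : realType.
Implicit Types (z w p v c : CC R) (x y h e : R) (g f : CC R -> CC R).
Implicit Types (u : nat -> CC R).

Lemma cvgC0D u u' : u @ \oo --> (0 : CC R) -> u' @ \oo --> (0 : CC R) ->
  u n + u' n @[n --> \oo] --> (0 : CC R).
Proof. by move=> u0 u'0; have := cvgD u0 u'0; rewrite addr0; apply. Qed.

Lemma cvgC0Z a u : u @ \oo --> (0 : CC R) -> a * u n @[n --> \oo] --> (0 : CC R).
Proof.
move=> /cvgC0P u0; apply/cvgC0P => e e0.
have a1 : 0 < nrm a + 1 by rewrite ltr_wpDl ?nrm_ge0.
have [N HN] := u0 _ (divr_gt0 e0 a1); exists N => n /HN; rewrite ler_pdivlMr// nrmM.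
by have := nrm_ge0 (u n); lra.
Qed.

Lemma cvgC0_sum (I : Type) (r : seq I) (F : I -> nat -> CC R) :
  (forall i, F i @ \oo --> (0 : CC R)) ->
  \sum_(i <- r) F i n @[n --> \oo] --> (0 : CC R).
Proof.
move=> F0; elim: r => [|i r IHr].
  by under eq_fun do rewrite big_nil; exact: cvg_cst.
by under eq_fun do rewrite big_cons; exact: cvgC0D.
Qed.

Lemma square_quarters q k w : square q (k + k) w ->
  [\/ square q k w, square (q + cx k 0) k w, square (q + cx 0 k) k w |
      square (q + cx k k) k w].
Proof.
rewrite /square /= => /andP[/andP[? ?] /andP[? ?]].
case: (leP (re w) (re q + k)) => ?; case: (leP (im w) (im q + k)) => ?.
- by apply: Or41; lra.
- by apply: Or43; rewrite !reimE; lra.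
- by apply: Or42; rewrite !reimE; lra.
- by apply: Or44; rewrite !reimE; lra.
Qed.

(** Compactness of the square for a monotone family of conditions: the maximum of four parameters
    serves the union of four quarters. It gives boundedness, a distance to the complement of U, and
    uniform convergence. *)
Lemma cousin_uniform (Q : R -> set (CC R)) p h : 0 < h ->
  (forall x y w, x <= y -> Q x w -> Q y w) ->
  (forall c, square p h c -> exists M r : R, 0 < r /\
     forall w, nrm (w - c) < r -> Q M w) ->
  exists M, square p h `<=` Q M.
Proof.
move=> h0 Qmono Qloc.
apply: (@cousin _ (fun q k => exists M, square q k `<=` Q M)) => //.
  move=> q k k0 [M1 H1] [M2 H2] [M3 H3] [M4 H4].
  exists (Num.max (Num.max M1 M2) (Num.max M3 M4)) => w /square_quarters[/H1|/H2|/H3|/H4];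
    by apply: Qmono; rewrite !le_max lexx ?orbT.
move=> c pc; have [M [r [r0 Hr]]] := Qloc c pc.
exists (r / 2); first by rewrite divr_gt0.
move=> q k /andP[k0 kr] qc; exists M => w qw; apply: Hr.
by apply: le_lt_trans (square_diam qc qw) _; lra.
Qed.

Lemma derivable_locally_bounded f z : derivable f z 1 ->
  exists M r : R, [/\ 0 < r, 0 <= M &
    forall w, nrm (w - z) < r -> nrm (f w - f z) <= M * nrm (w - z)].
Proof.
move=> /derivable_eps[d Hd]; have [r r0 Hr] := Hd 1 ltr01.
exists (nrm d + 1), r; split=> // [|w /Hr]; first by rewrite addr_ge0 ?nrm_ge0.
rewrite mul1r mulrDl mul1r -nrmM => le1.
by have := nrmD (f w - f z - d * (w - z)) (d * (w - z)); rewrite subrK; lra.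
Qed.

Lemma derivable_bounded_square f p h : 0 < h ->
  (forall c, square p h c -> derivable f c 1) ->
  exists M, forall w, square p h w -> nrm (f w) <= M.
Proof.
move=> h0 df; apply: (@cousin_uniform (fun M => [set w | nrm (f w) <= M])) => //.
  by move=> x y w xy /= /le_trans; apply.
move=> c /df /derivable_locally_bounded[M [r [r0 M0 Hr]]].
exists (M * r + nrm (f c)), r; split=> // w wr /=.
have := ler_wpM2l M0 (ltW wr); have := Hr w wr.
by have := nrmD (f w - f c) (f c); rewrite subrK; lra.
Qed.

Definition grid p h (a b : nat) : CC R := p + cx (a%:R * h) (b%:R * h).

Lemma sum_quarters m (F : nat -> nat -> CC R) :
  \sum_(a < m + m) \sum_(b < m + m) F a b =
  \sum_(a < m) \sum_(b < m) F a b + \sum_(a < m) \sum_(b < m) F (m + a)%N b +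
  \sum_(a < m) \sum_(b < m) F a (m + b)%N +
  \sum_(a < m) \sum_(b < m) F (m + a)%N (m + b)%N.
Proof.
rewrite big_split_ord /=.
under eq_bigr do rewrite big_split_ord /=.
rewrite big_split /=.
under [X in _ + X]eq_bigr do rewrite big_split_ord /=.
by rewrite big_split /=; ring.
Qed.

Lemma square_sum_grid n k g p h : square_sum (n + k) g p (h * 2 ^+ k) =
  \sum_(a < 2 ^ k) \sum_(b < 2 ^ k) square_sum n g (grid p h a b) h.
Proof.
elim: k p => [|k IHk] p.
  rewrite addn0 expr0 mulr1 !big_ord1; congr square_sum.
  by apply: eqC; rewrite !reimE /=; ring.
rewrite addnS exprS mulrCA (_ : 2 * _ = h * 2 ^+ k + h * 2 ^+ k); last by ring.
rewrite square_sum_split !IHk expnS mul2n -addnn.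
rewrite (sum_quarters _ (fun a b => square_sum n g (grid p h a b) h)).
congr (_ + _ + _ + _); apply: eq_bigr => a _; apply: eq_bigr => b _;
  congr square_sum; apply: eqC; rewrite !reimE ?natrD ?natrX; ring.
Qed.

Lemma sum_by_parts m (chi s : nat -> CC R) : chi 0%N = 0 -> chi m = 0 ->
  \sum_(i < m.+1) chi i * (s i - s i.+1) = \sum_(i < m) (chi i.+1 - chi i) * s i.+1.
Proof.
move=> chi0 chim.
under eq_bigr do rewrite mulrBr.
rewrite sumrB big_ord_recl chi0 mul0r add0r [X in _ - X]big_ord_recr /= chim mul0r addr0.
by rewrite -sumrB; apply: eq_bigr => i _; rewrite /bump add1n mulrBl.
Qed.

(** The weights are arbitrary because two choices occur: the indicator of the squares near K, and
    that indicator minus 1. *)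
Definition grid_sum m (chi : nat -> nat -> CC R) p h n g :=
  \sum_(a < m.+1) \sum_(b < m.+1) chi a b * square_sum n g (grid p h a b) h.

Lemma grid_sumD m chi p h n g1 g2 :
  grid_sum m chi p h n (fun w => g1 w + g2 w) =
  grid_sum m chi p h n g1 + grid_sum m chi p h n g2.
Proof.
rewrite /grid_sum -big_split; apply: eq_bigr => a _.
rewrite -big_split; apply: eq_bigr => b _.
by rewrite square_sumD mulrDr.
Qed.

Lemma grid_sumZ m chi p h n c g :
  grid_sum m chi p h n (fun w => c * g w) = c * grid_sum m chi p h n g.
Proof.
rewrite /grid_sum mulr_sumr; apply: eq_bigr => a _.
rewrite mulr_sumr; apply: eq_bigr => b _.
by rewrite square_sumZ mulrCA.
Qed.

Lemma eq_grid_sum m chi p h n g1 g2 : g1 =1 g2 ->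
  grid_sum m chi p h n g1 = grid_sum m chi p h n g2.
Proof.
move=> eg; apply: eq_bigr => a _; apply: eq_bigr => b _.
by rewrite (eq_square_sum _ _ _ eg).
Qed.

(* Edges shared by two squares of equal weight cancel: only the boundary of the
   support of chi remains. *)
Lemma grid_sum_edges m chi p h n g :
  (forall i, chi i 0%N = 0) -> (forall i, chi i m = 0) ->
  (forall i, chi 0%N i = 0) -> (forall i, chi m i = 0) ->
  grid_sum m chi p h n g =
  \sum_(a < m.+1) \sum_(b < m) (chi a b.+1 - chi a b) *
     edge_sum n g (grid p h a b.+1) (cx h 0) +
  \sum_(b < m.+1) \sum_(a < m) (chi a b - chi a.+1 b) *
     edge_sum n g (grid p h a.+1 b) (cx 0 h).
Proof.
move=> chib0 chibm chia0 chiam; rewrite /grid_sum.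
pose H a b := edge_sum n g (grid p h a b) (cx h 0).
pose V a b := edge_sum n g (grid p h a b) (cx 0 h).
have gridS a b : grid p h a b + cx h 0 = grid p h a.+1 b.
  by apply: eqC; rewrite !reimE -?(natr1 a); ring.
have gridS' a b : grid p h a b + cx 0 h = grid p h a b.+1.
  by apply: eqC; rewrite !reimE -?(natr1 b); ring.
transitivity (\sum_(a < m.+1) \sum_(b < m.+1) chi a b * (H a b - H a b.+1) -
  \sum_(b < m.+1) \sum_(a < m.+1) chi a b * (V a b - V a.+1 b)).
  rewrite [X in _ = _ - X]exchange_big -sumrB; apply: eq_bigr => a _.
  rewrite -sumrB; apply: eq_bigr => b _.
  by rewrite /square_sum gridS gridS' /H /V; ring.
congr (_ + _); first by apply: eq_bigr => a _; rewrite sum_by_parts.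
rewrite -sumrN; apply: eq_bigr => b _.
rewrite (@sum_by_parts m (chi ^~ b) (V ^~ b))// -sumrN.
by apply: eq_bigr => a _; rewrite -mulNr opprB.
Qed.

(** The list of pairs (node, weight) is fixed before g: the same list will serve every f(ω,.), which
    is the source of measurability. *)
Definition nodal (A : set (CC R)) (phi : (CC R -> CC R) -> CC R) :=
  exists s : seq (CC R * CC R), (forall xc, xc \in s -> A xc.1) /\
    forall g, phi g = \sum_(xc <- s) xc.2 * g xc.1.

Lemma eq_nodal A phi psi : phi =1 psi -> nodal A psi -> nodal A phi.
Proof. by move=> epsi [s [sA Hs]]; exists s; split=> // g; rewrite epsi. Qed.

Lemma nodal0 A : nodal A (fun=> 0).
Proof. by exists [::]; split=> // g; rewrite big_nil. Qed.

Lemma nodalD A phi psi : nodal A phi -> nodal A psi ->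
  nodal A (fun g => phi g + psi g).
Proof.
move=> [s [sA Hs]] [t [tA Ht]]; exists (s ++ t); split=> [xc|g].
  by rewrite mem_cat => /orP[/sA|/tA].
by rewrite big_cat Hs Ht.
Qed.

Lemma nodalZ A a phi : nodal A phi -> nodal A (fun g => a * phi g).
Proof.
move=> [s [sA Hs]]; exists [seq (xc.1, a * xc.2) | xc <- s].
split=> [_ /mapP[xc /sA ? ->]//|g].
by rewrite Hs mulr_sumr big_map; apply: eq_bigr => xc _; rewrite mulrA.
Qed.

Lemma nodal_sum A (I : Type) (r : seq I) (phi : I -> (CC R -> CC R) -> CC R) :
  (forall i, nodal A (phi i)) -> nodal A (fun g => \sum_(i <- r) phi i g).
Proof.
move=> H; elim: r => [|i r IHr].
  by under eq_fun do rewrite big_nil; exact: nodal0.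
by under eq_fun do rewrite big_cons; exact: nodalD.
Qed.

Lemma nodal_edge_sum A n p v : segment p v `<=` A ->
  nodal A (fun g => edge_sum n g p v).
Proof.
elim: n p v => [|n IHn] p v pA /=.
  exists [:: (p + v / 2, v)]; split=> [xc|g]; last by rewrite big_seq1.
  by rewrite inE => /eqP->; apply: pA; exact: segment_mid.
apply: nodalD; apply: IHn => w pw; apply: pA; [exact: segment_l|exact: segment_r].
Qed.

(** The constant does not depend on n; this turns convergence at each point of K into uniform
    convergence. *)
Definition equilipschitz (K : set (CC R)) (phi : nat -> CC R -> CC R) :=
  exists C : R, 0 <= C /\ forall n z z', K z -> K z' ->
    nrm (phi n z - phi n z') <= C * nrm (z - z').

Lemma eq_equilipschitz K phi psi : phi =2 psi ->
  equilipschitz K psi -> equilipschitz K phi.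
Proof.
by move=> epsi [C [C0 HC]]; exists C; split=> // n z z'; rewrite !epsi; exact: HC.
Qed.

Lemma equilipschitz0 K : equilipschitz K (fun _ _ => 0).
Proof. by exists 0; split=> // n z z' _ _; rewrite subrr nrm0 mul0r. Qed.

Lemma equilipschitzD K phi psi : equilipschitz K phi -> equilipschitz K psi ->
  equilipschitz K (fun n z => phi n z + psi n z).
Proof.
move=> [C [C0 HC]] [D [D0 HD]]; exists (C + D); split=> [|n z z' Kz Kz'].
  exact: addr_ge0.
rewrite opprD addrACA mulrDl; apply: le_trans (nrmD _ _) _.
by apply: lerD; [exact: HC|exact: HD].
Qed.

Lemma equilipschitzZ K (a : nat -> CC R) M phi : (forall n, nrm (a n) <= M) ->
  equilipschitz K phi -> equilipschitz K (fun n z => a n * phi n z).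
Proof.
move=> aM [C [C0 HC]]; exists (M * C).
have M0 : 0 <= M by exact: le_trans (nrm_ge0 _) (aM 0%N).
split=> [|n z z' Kz Kz']; first exact: mulr_ge0.
by rewrite -mulrBr nrmM -mulrA ler_pM ?nrm_ge0 ?HC.
Qed.

Lemma equilipschitz_sum K (I : Type) (r : seq I) (phi : I -> nat -> CC R -> CC R) :
  (forall i, equilipschitz K (phi i)) ->
  equilipschitz K (fun n z => \sum_(i <- r) phi i n z).
Proof.
move=> H; elim: r => [|i r [C [C0 HC]]].
  by exists 0; split=> // n z z' _ _; rewrite !big_nil subrr nrm0 mul0r.
have [D [D0 HD]] := equilipschitzD (H i) (ex_intro _ C (conj C0 HC)).
by exists D; split=> // n z z' Kz Kz'; rewrite !big_cons; exact: HD.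
Qed.

(** The identity 1/(w - z) - 1/(w - z') = (z - z')/((w - z)(w - z')) bounds the integrand, and
    [edge_sum_le] transfers this to all levels alike. *)
Lemma equilipschitz_edge_sum (K : set (CC R)) f p v M e : 0 < e ->
  (forall w, segment p v w -> nrm (f w) <= M) ->
  (forall w z, segment p v w -> K z -> e <= nrm (w - z)) ->
  equilipschitz K (fun n z => edge_sum n (fun w => f w / (w - z)) p v).
Proof.
move=> e0 fM far; have M0 : 0 <= M.
  by apply: le_trans (fM _ (segment_mid p v)); exact: nrm_ge0.
exists (nrm v * (M * (e^-1 * e^-1))); split=> [|n z z' Kz Kz'].
  by rewrite !mulr_ge0 ?nrm_ge0 ?invr_ge0 ?(ltW e0).
rewrite -[- edge_sum _ _ _ _]mulN1r -edge_sumZ -edge_sumD -!mulrA.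
apply: edge_sum_le => w pw; have le_e := far w _ pw Kz; have le_e' := far w _ pw Kz'.
have wz : 0 < nrm (w - z) by exact: lt_le_trans le_e.
have wz' : 0 < nrm (w - z') by exact: lt_le_trans le_e'.
rewrite (_ : _ + _ = f w * ((w - z)^-1 * (w - z')^-1 * (z - z'))); last first.
  by field; rewrite -!nrm_gt0 wz wz'.
rewrite !nrmM !nrmV ler_pM ?nrm_ge0 ?fM ?mulr_ge0 ?invr_ge0 ?nrm_ge0//.
rewrite mulrA ler_wpM2r ?nrm_ge0// ler_pM ?invr_ge0 ?nrm_ge0// lef_pV2 ?posrE//.
Qed.

End Grid.

(** * Runge approximation with nodes and weights common to all f *)

Section Runge.
Variable R : realType.
Implicit Types (z w p v c : CC R) (x y h e : R) (g f : CC R -> CC R).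
Implicit Types (U K : set (CC R)).

Lemma compact_open_margin K U : compact K -> open U -> K `<=` U ->
  exists2 eta : R, 0 < eta & forall z w, K z -> nrm (w - z) < eta -> U w.
Proof.
move=> cK oU KU; have [M KM] := compact_nrm_bounded cK.
pose N := `|M| + 1; have N0 : 0 < N by rewrite ltr_wpDl.
(* The parameter x stands for the margin 1/x, so that the condition weakens as x grows. Away from K
   it holds vacuously. *)
have [||c _|C HC] := @cousin_uniform R
    (fun x => [set z | 0 < x /\ forall w, K z -> nrm (w - z) < x^-1 -> U w])
    (cx (- N) (- N)) (N + N).
- exact: addr_gt0.
- move=> x y z xy [x0 H]; split=> [|w Kz wz]; first exact: lt_le_trans xy.
  by apply: H => //; apply: lt_le_trans wz _; rewrite lef_pV2// posrE (lt_le_trans x0).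
- have [Kc|Kc] := pselect (K c).
    have [r r0 Hr] := open_eps oU (KU _ Kc).
    exists (2 / r), (r / 2); split=> [|z zc]; first by rewrite divr_gt0.
    split=> [|w _ wz]; first by rewrite divr_gt0.
    apply: Hr; rewrite invf_div in wz.
    by have := nrm_triangle z w c; lra.
  have [r r0 Hr] := compact_compl_eps cK Kc.
  by exists 1, r; split=> // z /Hr.
have [[z0 Kz0]|K0] := pselect (exists z, K z); last first.
  by exists 1 => // z w Kz; case: K0; exists z.
have KS z : K z -> square (cx (- N) (- N)) (N + N) z.
  move=> /KM zM; have := re_le_nrm z; have := im_le_nrm z; have := ler_norm M.
  by rewrite !ler_norml /square /= /N; lra.
exists C^-1; first by have [C0 _] := HC _ (KS _ Kz0); rewrite invr_gt0.
by move=> z w Kz; have [_] := HC _ (KS _ Kz); apply.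
Qed.

Lemma derivable_diff_quotient f z c : derivable f c 1 -> c != z ->
  derivable (fun w => (f w - f z) / (w - z)) c 1.
Proof.
move=> df cz; apply: (@derivableM _ _ (fun w => f w - f z)).
  by apply: (derivableB df); exact: derivable_cst.
exact: derivable_subV.
Qed.

(** At w = z the quotient is 0 by the convention x/0 = 0, not f'(z); it is bounded near z all the
    same, as [goursat] requires. *)
Lemma diff_quotient_bounded f z : derivable f z 1 ->
  exists M r : R, 0 < r /\ forall w, nrm (w - z) < r -> nrm ((f w - f z) / (w - z)) <= M.
Proof.
move=> /derivable_locally_bounded[M [r [r0 M0 Hr]]]; exists M, r; split=> // w /Hr.
have [->|wz] := eqVneq w z; first by rewrite !subrr mul0r nrm0.
by rewrite nrmM nrmV ler_pdivrMr// nrm_gt0 subr_eq0.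
Qed.

Theorem runge_quadrature U K : open U -> compact K -> K `<=` U ->
  exists s : nat -> seq (CC R * CC R),
    (exists2 r : R, 0 < r & forall n xc, xc \in s n ->
       U xc.1 /\ forall z, K z -> r <= nrm (xc.1 - z)) /\
    forall f, holomorphic_on U f ->
      forall e, 0 < e -> exists N, forall n, (N <= n)%N -> forall z, K z ->
        nrm (\sum_(xc <- s n) xc.2 * (f xc.1 / (xc.1 - z)) - f z) <= e.
Proof.
move=> oU cK KU; have [eta eta0 Heta] := compact_open_margin cK oU KU.
have [B [B0 KB]] : exists B, 0 < B /\ forall z, K z -> nrm z <= B.
  have [M HM] := compact_nrm_bounded cK; exists (`|M| + 1); split.
    by rewrite ltr_wpDl.
  by move=> z /HM; have := ler_norm M; lra.
have eta12 : 0 < eta / 12 by rewrite divr_gt0.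
(* A square of side h is called near when its corner is within 10h of K. Its points are within 2h of
   the corner, so near squares lie in U by 12h < eta and the others stay 8h away from K. The large
   square has half side 2B; its border squares are at distance at least B - h >= 15h from K, hence
   not near. *)
have [k [h [h0 hB heta hk]]] : exists k h, [/\ 0 < h, 16 * h <= B, 12 * h < eta &
    h * 2 ^+ k = 4 * B].
  have [k Hk] := exp2_gt (4 * B) eta12.
  have k0 : 0 < 2 ^+ k :> R by rewrite exprn_gt0.
  have k1 : 1 <= 2 ^+ k :> R by rewrite exprn_ege1// ler1n.
  (* The factor 2^6 = 64 = 4 * 16 turns 16h into B / 2^k. *)
  exists (k + 6)%N, (4 * B / 2 ^+ (k + 6)).
  have -> : 4 * B / 2 ^+ (k + 6) = 4 * B / 2 ^+ k / 64.
    by rewrite exprD (_ : 2 ^+ 6 = 64); [field; rewrite gt_eqF|ring].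
  split.
  - by rewrite !divr_gt0// mulr_gt0.
  - rewrite (_ : 16 * _ = B / 2 ^+ k); last by field; rewrite gt_eqF.
    by rewrite ler_pdivrMr// ler_peMr// ltW.
  - have : 0 < 4 * B / 2 ^+ k by rewrite divr_gt0// mulr_gt0.
    lra.
  - by rewrite exprD (_ : 2 ^+ 6 = 64); [field; rewrite gt_eqF|ring].
set H := 4 * B in hk; have H0 : 0 < H by rewrite mulr_gt0.
pose P := 0 - cx (H / 2) (H / 2).
have [m hm] : exists m, (2 ^ k)%N = m.+1.
  by exists (2 ^ k).-1; rewrite prednK// expn_gt0.
have hmR : m%:R * h = H - h.
  by rewrite -hk -natrX hm -natr1; ring.
pose near p := exists z, K z /\ nrm (p - z) <= 10 * h.
pose chi a b : CC R := (`[< near (grid P h a b) >])%:R.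
have near_U p : near p -> square p h `<=` U.
  move=> [z [Kz pz]] w /square_nrm wp; apply: (Heta z) => //.
  by have := nrm_triangle p w z; lra.
have far_K p : ~ near p -> forall w z, square p h w -> K z -> 8 * h <= nrm (w - z).
  move=> np w z /square_nrm wp Kz; rewrite leNgt; apply/negP => wz.
  by apply: np; exists z; split=> //; have := nrm_triangle w p z; rewrite (nrmB p w); lra.
have chi0 a b : ~ near (grid P h a b) -> chi a b = 0 by move=> ?; rewrite /chi asboolF.
have KreP z : K z -> `|re z| <= B by move=> /KB; exact/le_trans/re_le_nrm.
have KimP z : K z -> `|im z| <= B by move=> /KB; exact/le_trans/im_le_nrm.
have hH : H = 4 * B by [].
have chi_b0 a : chi a 0%N = 0.
  apply: chi0 => -[z [/KimP Kz]]; have := im_le_nrm (grid P h a 0 - z).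
  by move: Kz; rewrite !ler_norml !reimE; lra.
have chi_bm a : chi a m = 0.
  apply: chi0 => -[z [/KimP Kz]]; have := im_le_nrm (grid P h a m - z).
  by move: Kz; rewrite !ler_norml !reimE hmR; lra.
have chi_a0 b : chi 0%N b = 0.
  apply: chi0 => -[z [/KreP Kz]]; have := re_le_nrm (grid P h 0 b - z).
  by move: Kz; rewrite !ler_norml !reimE; lra.
have chi_am b : chi m b = 0.
  apply: chi0 => -[z [/KreP Kz]]; have := re_le_nrm (grid P h m b - z).
  by move: Kz; rewrite !ler_norml !reimE hmR; lra.
have edgeE n g := grid_sum_edges P h n g chi_b0 chi_bm chi_a0 chi_am.
pose A : set (CC R) := [set w | U w /\ forall z, K z -> 8 * h <= nrm (w - z)].
(* An edge with nonzero coefficient separates a near square from one that is not: the former puts it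
   in U, the latter keeps it away from K. The near square is recorded because f is bounded on it. *)
have edgeA p q S : S `<=` square p h -> S `<=` square q h ->
    (`[< near p >])%:R - (`[< near q >])%:R != 0 :> CC R ->
    S `<=` A /\ exists p', near p' /\ S `<=` square p' h.
  move=> Sp Sq; case: asboolP => np; case: asboolP => nq; rewrite ?subrr ?eqxx// => _.
    split; last by exists p.
    by move=> w Sw; split=> [|z]; [exact: near_U (Sp _ Sw)|exact: far_K (Sq _ Sw)].
  split; last by exists q.
  by move=> w Sw; split=> [|z]; [exact: near_U (Sq _ Sw)|exact: far_K (Sp _ Sw)].
have segH a b : segment (grid P h a b.+1) (cx h 0) `<=` square (grid P h a b.+1) h /\
    segment (grid P h a b.+1) (cx h 0) `<=` square (grid P h a b) h.
  split=> w; first by move=> /(segment_bottom (ltW h0))[].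
  rewrite (_ : grid P h a b.+1 = grid P h a b + cx 0 h).
    by move=> /(segment_top (ltW h0))[].
  by apply: eqC; rewrite !reimE -?(natr1 b); ring.
have segV a b : segment (grid P h a.+1 b) (cx 0 h) `<=` square (grid P h a b) h /\
    segment (grid P h a.+1 b) (cx 0 h) `<=` square (grid P h a.+1 b) h.
  split=> w; last by move=> /(segment_left (ltW h0))[].
  rewrite (_ : grid P h a.+1 b = grid P h a b + cx h 0).
    by move=> /(segment_right (ltW h0))[].
  by apply: eqC; rewrite !reimE -?(natr1 a); ring.
pose T n g := grid_sum m chi P h n g.
have nodalT n : nodal A (T n).
  (* The squares of positive weight cover K, so only the form over edges shows that the surviving
     nodes avoid K. *)
  apply: (eq_nodal (edgeE n)).
  apply: nodalD; apply: nodal_sum => i; apply: nodal_sum => j.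
    have [->|c0] := eqVneq (chi i j.+1 - chi i j) 0.
      by under eq_fun do rewrite mul0r; exact: nodal0.
    apply: nodalZ; apply: nodal_edge_sum.
    by have [s1 s2] := segH i j; have [] := edgeA _ _ _ s1 s2 c0.
  have [->|c0] := eqVneq (chi j i - chi j.+1 i) 0.
    by under eq_fun do rewrite mul0r; exact: nodal0.
  apply: nodalZ; apply: nodal_edge_sum.
  by have [s1 s2] := segV j i; have [] := edgeA _ _ _ s1 s2 c0.
(* Level n + k on the large square amounts to level n on each of its 2^k by 2^k cells. Writing
   [w - 0] exhibits the centre c = 0 of [im_square_sum_center]. *)
pose kappa n := square_sum (n + k) (fun w => (w - 0)^-1) P H.
have kappa4 n : 4 <= nrm (kappa n).
  apply: le_trans (le_trans (ler_norm _) (im_le_nrm _)).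
  exact: im_square_sum_center.
have kappaN0 n : kappa n != 0 by rewrite -nrm_gt0 (lt_le_trans _ (kappa4 n)).
have kappaV n : nrm (kappa n)^-1 <= 1.
  by rewrite nrmV invf_le1 ?nrm_gt0//; have := kappa4 n; lra.
have [s Hs] := choice (fun n => nodalZ (kappa n)^-1 (nodalT n)).
exists s; split.
  exists (8 * h); first by rewrite mulr_gt0.
  by move=> n xc; have [sA _] := Hs n; move=> /sA.
move=> f hf.
pose F n z := (kappa n)^-1 * T n (fun w => f w / (w - z)).
have sF n z : \sum_(xc <- s n) xc.2 * (f xc.1 / (xc.1 - z)) = F n z.
  by have [_ sE] := Hs n; rewrite /F (sE (fun w => f w / (w - z))).
suff unif e : 0 < e -> exists N, forall n, (N <= n)%N -> forall z, K z ->
    nrm (F n z - f z) <= e.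
  by move=> e /unif[N HN]; exists N => n nN z Kz; rewrite sF; exact: HN.
have Flip : equilipschitz K F.
  apply: equilipschitzZ kappaV _.
  apply: (eq_equilipschitz (fun n z => edgeE n (fun w => f w / (w - z)))).
  have lipE p' p v : near p' -> segment p v `<=` square p' h -> segment p v `<=` A ->
      equilipschitz K (fun n z => edge_sum n (fun w => f w / (w - z)) p v).
    move=> np' sp sA.
    have [|M HM] := derivable_bounded_square (f := f) (p := p') h0.
      by move=> c pc; apply: hf; exact: near_U pc.
    apply: (@equilipschitz_edge_sum _ _ _ _ _ M (8 * h)).
    - by rewrite mulr_gt0.
    - by move=> w /sp; exact: HM.
    - by move=> w z /sA[_]; apply.
  have lipZ (a : CC R) phi : equilipschitz K phi -> equilipschitz K (fun n z => a * phi n z).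
    by apply: equilipschitzZ => n.
  apply: equilipschitzD; apply: equilipschitz_sum => i; apply: equilipschitz_sum => j.
    have [->|c0] := eqVneq (chi i j.+1 - chi i j) 0.
      by under eq_fun do under eq_fun do rewrite mul0r; exact: equilipschitz0.
    apply: lipZ; have [s1 s2] := segH i j.
    by have [sA [p' [np' sp]]] := edgeA _ _ _ s1 s2 c0; exact: lipE sp sA.
  have [->|c0] := eqVneq (chi j i - chi j.+1 i) 0.
    by under eq_fun do under eq_fun do rewrite mul0r; exact: equilipschitz0.
  apply: lipZ; have [s1 s2] := segV j i.
  by have [sA [p' [np' sp]]] := edgeA _ _ _ s1 s2 c0; exact: lipE sp sA.
have Fcvg z : K z -> F n z - f z @[n --> \oo] --> (0 : CC R).
  move=> Kz.
  pose g w := (f w - f z) / (w - z).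
  have Tg : T n g @[n --> \oo] --> (0 : CC R).
    apply: cvgC0_sum => a; apply: cvgC0_sum => b.
    rewrite /chi; case: asboolP => nab; last first.
      by under eq_fun do rewrite mul0r; exact: cvg_cst.
    apply: cvgC0Z; apply: (goursat (z := z)) => // [c pc cz|_].
      by apply: derivable_diff_quotient => //; apply: hf; exact: near_U pc.
    by apply: diff_quotient_bounded; apply: hf; exact: KU.
  have Tinv : T n (fun w => (w - z)^-1) - kappa n @[n --> \oo] --> (0 : CC R).
    (* The near squares are all the cells minus those not near. The latter, of weight -1, do not
       contain z and contribute null sequences; on the whole large square, z is then traded for
       0. *)
    have -> : (fun n => T n (fun w => (w - z)^-1) - kappa n) = fun n =>
        grid_sum m (fun a b => chi a b - 1) P h n (fun w => (w - z)^-1) +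
        square_sum (n + k) (fun w => (w - z)^-1 - (w - 0)^-1) P H.
      apply/funext => n.
      rewrite (@eq_square_sum _ (n + k) _ (fun w => (w - z)^-1 + (-1) * (w - 0)^-1)).
        2: by move=> w; rewrite mulN1r.
      rewrite square_sumD square_sumZ mulN1r addrA; congr (_ - _).
      rewrite -hk square_sum_grid hm /T /grid_sum -big_split; apply: eq_bigr => a _.
      rewrite -big_split; apply: eq_bigr => b _.
      by rewrite /=; ring.
    apply: cvgC0D.
      apply: cvgC0_sum => a; apply: cvgC0_sum => b.
      rewrite /chi; case: asboolP => nab.
        by rewrite subrr; under eq_fun do rewrite mul0r; exact: cvg_cst.
      apply: cvgC0Z; apply: square_sum_subV_cvg0 => // pz.
      by have := far_K _ nab _ _ pz Kz; rewrite subrr nrm0; lra.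
    have /cvgC0P D0 : square_sum n (fun w => (w - z)^-1 - (w - 0)^-1) P H
        @[n --> \oo] --> (0 : CC R).
      apply: square_sum_subVB_cvg0 => //; rewrite /open_square /= ?reimE.
        by have := KreP z Kz; have := KimP z Kz; rewrite !ler_norml; lra.
      lra.
    apply/cvgC0P => d /D0[N HN]; exists N => n nN; apply: HN.
    exact: leq_trans nN (leq_addr _ _).
  have /cvgC0P D0 := cvgC0D Tg (cvgC0Z (f z) Tinv).
  apply/cvgC0P => d /D0[N HN]; exists N => n /HN.
  rewrite mulrBr addrA -grid_sumZ -grid_sumD.
  rewrite -(@eq_grid_sum _ _ _ _ _ _ (fun w => f w / (w - z))); last first.
    by move=> w; rewrite /g mulrBl subrK.
  apply: le_trans.
  rewrite (_ : F n z - f z = (kappa n)^-1 * (T n (fun w => f w / (w - z)) - f z * kappa n)).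
    by rewrite nrmM ler_piMl ?nrm_ge0.
  by rewrite mulrBr /F (mulrC (f z)) mulKf.
move=> e0.
have BS z : K z -> square P H z.
  move=> Kz; have := KreP z Kz; have := KimP z Kz.
  by rewrite !ler_norml /square /= ?reimE; lra.
(* The rank from which the estimate holds is read as a real parameter, so that [cousin_uniform]
   produces one rank for all of K. *)
have [x y z xy Hx N xN|c _|M HM] := @cousin_uniform R (fun x => [set z | forall n : nat,
   x <= n%:R -> K z -> nrm (F n z - f z) <= e]) P H H0.
- by apply: Hx; exact: le_trans xN.
- have [Kc|Kc] := pselect (K c); last first.
    have [r r0 Hr] := compact_compl_eps cK Kc.
    by exists 0, r; split=> // z /Hr Kz n _ /Kz.
  have [C [C0 HC]] := Flip.
  have [L [r [r0 L0 Hr]]] := derivable_locally_bounded (hf _ (KU _ Kc)).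
  have e2 : 0 < e / 2 by rewrite divr_gt0.
  have /cvgC0P/(_ _ e2)[N HN] := Fcvg c Kc.
  have CL : 0 < C + L + 1 by rewrite ltr_wpDl ?addr_ge0.
  (* Half of e is spent at c; moving from c to z costs C|z - c| for [F n] and L|z - c| for f. *)
  exists N%:R, (Num.min r (e / 2 / (C + L + 1))); split.
    by rewrite lt_min r0 divr_gt0.
  move=> z; rewrite lt_min => /andP[zr ze] n; rewrite ler_nat => /HN FN Kz.
  have := HC n z c Kz Kc; have := Hr z zr; move: ze; rewrite ltr_pdivlMr//.
  have := nrmD (F n z - F n c + (F n c - f c)) (f c - f z).
  have := nrmD (F n z - F n c) (F n c - f c).
  rewrite (nrmB (f c)) !subrKA.
  have := nrm_ge0 (z - c).
  lra.
exists (Num.bound `|M|) => n nM z Kz; apply: HM => //; first exact: BS.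
apply: le_trans (ler_norm _) _; apply/ltW/(lt_le_trans (archi_boundP (normr_ge0 M))).
by rewrite ler_nat.
Qed.

End Runge.

(** * Measurability of complex-valued maps *)

Section MeasurableComplex.
Variables (d : measure_display) (Omega : measurableType d) (R : realType).
Implicit Types (g h : Omega -> CC R).

Lemma measurable_C_open g :
  (forall A : set (CC R), open A -> measurable (g @^-1` A)) -> measurable_C g.
Proof.
move=> mg; apply: (@smallest_sub _ _ _ [set B | measurable (g @^-1` B)]) => //.
split=> /= [|A mA|F mF].
- by rewrite preimage_set0.
- by rewrite setTD preimage_setC; exact: measurableC.
- by rewrite preimage_bigcup; exact: bigcup_measurable.
Qed.

Lemma measurable_C_preimage_open g (A : set (CC R)) :
  measurable_C g -> open A -> measurable (g @^-1` A).
Proof. by move=> mg oA; apply: mg; exact: sub_sigma_algebra. Qed.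

Lemma measurable_C_cst (c : CC R) : measurable_C (fun _ : Omega => c).
Proof.
by move=> B _; rewrite preimage_cst; case: ifP => _; [exact: measurableT|exact: measurable0].
Qed.

Definition cball (c : CC R) (r : R) : set (CC R) := [set w | nrm (w - c) < r].

Lemma open_cball c r : open (cball c r).
Proof.
rewrite openE => w; rewrite /cball /= => wc; apply/nbhs_ballP.
exists (cx (r - nrm (w - c)) 0); first by rewrite /= ltC subr_gt0.
move=> v; rewrite /ball/= norm_ltC /cball /= (nrmB w v) => vw.
by have := nrm_triangle w v c; lra.
Qed.

Lemma rat_approx (x e : R) : 0 < e -> exists q : rat, `|x - ratr q| < e.
Proof.
move=> e0; have [|q] := @rat_in_itvoo R (x - e) (x + e); first by lra.
by rewrite in_itv /= => qx; exists q; rewrite ltr_norml; lra.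
Qed.

(* Open sets of C x C are countable unions of products of balls with rational
   data, so no product sigma-algebra is needed. *)
Lemma measurable_C_continuous2 (phi : CC R -> CC R -> CC R) g h :
  (forall u v e, 0 < e -> exists2 r, 0 < r & forall u' v',
     nrm (u' - u) < r -> nrm (v' - v) < r -> nrm (phi u' v' - phi u v) < e) ->
  measurable_C g -> measurable_C h -> measurable_C (fun w => phi (g w) (h w)).
Proof.
move=> cphi mg mh; apply: measurable_C_open => A oA.
pose T := (rat * rat * rat * rat * nat)%type.
pose c1 (t : T) : CC R := cx (ratr t.1.1.1.1) (ratr t.1.1.1.2).
pose c2 (t : T) : CC R := cx (ratr t.1.1.2) (ratr t.1.2).
pose rad (t : T) : R := t.2.+1%:R^-1.
pose inA (t : T) := forall u v, nrm (u - c1 t) < rad t -> nrm (v - c2 t) < rad t ->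
  A (phi u v).
pose F (t : T) := if `[< inA t >] then
  g @^-1` cball (c1 t) (rad t) `&` h @^-1` cball (c2 t) (rad t) else set0.
suff -> : (fun w => phi (g w) (h w)) @^-1` A = \bigcup_t F t.
  apply: countable_bigcupT_measurable; first exact: countableP.
  move=> t; rewrite /F; case: ifP => _; last exact: measurable0.
  by apply: measurableI; apply: measurable_C_preimage_open => //; exact: open_cball.
apply/seteqP; split=> w /=; last first.
  by move=> [t _]; rewrite /F; case: asboolP => // At [gt ht]; exact: At.
move=> Aw; have [e e0 He] := open_eps oA Aw.
have [r r0 Hr] := cphi (g w) (h w) e e0.
have r2 : 0 < r / 2 by rewrite divr_gt0.
(* The balls have radius s = 1/(n + 1) < r/2. Rational coordinates within s/2 put each centre within
   s of the given value, so every point of a ball is within 2s < r of it. *)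
pose n := Num.bound (r / 2)^-1.
have nr : n.+1%:R^-1 < r / 2.
  rewrite -[ltRHS]invrK ltf_pV2 ?posrE ?invr_gt0//.
  apply: lt_le_trans (archi_boundP _) _; first by rewrite invr_ge0 ltW.
  by rewrite ler_nat.
set s : R := n.+1%:R^-1 in nr; have s0 : 0 < s by rewrite invr_gt0.
have s2 : 0 < s / 2 by rewrite divr_gt0.
have [q1 H1] := rat_approx (re (g w)) s2.
have [q2 H2] := rat_approx (im (g w)) s2.
have [q3 H3] := rat_approx (re (h w)) s2.
have [q4 H4] := rat_approx (im (h w)) s2.
exists (q1, q2, q3, q4, n) => //; rewrite /F.
have gq : nrm (g w - cx (ratr q1) (ratr q2)) < s.
  by apply: le_lt_trans (nrm_le_reim _) _; rewrite !reimE; lra.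
have hq : nrm (h w - cx (ratr q3) (ratr q4)) < s.
  by apply: le_lt_trans (nrm_le_reim _) _; rewrite !reimE; lra.
rewrite asboolT// => u v; rewrite /c1 /c2 /rad /= -/s => uq vq; apply: He; apply: Hr.
  have := nrm_triangle (cx (ratr q1) (ratr q2)) u (g w).
  by rewrite (nrmB (cx _ _) (g w)); lra.
have := nrm_triangle (cx (ratr q3) (ratr q4)) v (h w).
by rewrite (nrmB (cx _ _) (h w)); lra.
Qed.

Lemma measurable_CD g h : measurable_C g -> measurable_C h ->
  measurable_C (fun w => g w + h w).
Proof.
apply: measurable_C_continuous2 => u v e e0; exists (e / 2); first by rewrite divr_gt0.
move=> u' v' uu vv; rewrite opprD addrACA.
by have := nrmD (u' - u) (v' - v); lra.
Qed.

Lemma measurable_CZ c g : measurable_C g -> measurable_C (fun w => c * g w).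
Proof.
move=> mg; apply: (@measurable_C_continuous2 (fun u _ => c * u) g g) => // u v e e0.
have c1 : 0 < nrm c + 1 by rewrite ltr_wpDl ?nrm_ge0.
exists (e / (nrm c + 1)); first by rewrite divr_gt0.
move=> u' _ + _; rewrite ltr_pdivlMr// -mulrBr nrmM.
by have := nrm_ge0 (u' - u); lra.
Qed.

Lemma measurable_C_sum (I : eqType) (r : seq I) (F : I -> Omega -> CC R) :
  (forall i, i \in r -> measurable_C (F i)) ->
  measurable_C (fun w => \sum_(i <- r) F i w).
Proof.
elim: r => [_|i r IHr mF].
  by under eq_fun do rewrite big_nil; exact: measurable_C_cst.
under eq_fun do rewrite big_cons.
apply: measurable_CD; first by apply: mF; rewrite mem_head.
by apply: IHr => j jr; apply: mF; rewrite in_cons jr orbT.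
Qed.

Lemma measurable_C_if_eq0 g c : measurable_C g ->
  measurable_C (fun w => if g w == 0 then c else g w).
Proof.
move=> mg B mB.
have m0 : measurable (g @^-1` [set 0]).
  rewrite -[_ @^-1` _]setCK preimage_setC; apply: measurableC.
  apply: measurable_C_preimage_open => //; rewrite openC.
  by apply: accessible_closed_set1; apply: hausdorff_accessible; exact: norm_hausdorff.
rewrite (_ : _ @^-1` B = (g @^-1` [set 0] `&` (fun=> c) @^-1` B) `|`
    (g @^-1` B `\` g @^-1` [set 0])).
  apply: measurableU; first by apply: measurableI => //; exact: measurable_C_cst.
  by apply: measurableD => //; exact: mg.
apply/seteqP; split=> w /=.
  by case: eqVneq => [g0 Bc|g0 Bg]; [left|right; split=> //; apply/eqP].
by case=> [[-> Bc]|[Bg /eqP/negPf->]]; rewrite ?eqxx.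
Qed.

End MeasurableComplex.

(** * Random rational functions with prescribed poles *)

Section RandomRational.
Variables (d : measure_display) (Omega : measurableType d) (R : realType).
Implicit Types (K : set (CC R)) (t : seq (CC R)) (a : CC R -> Omega -> CC R).

Lemma coprimep_prod_XsubC (p : {poly CC R}) t :
  (forall v, v \in t -> ~~ root p v) -> coprimep p (\prod_(v <- t) ('X - v%:P)).
Proof.
elim: t => [_|v t IHt pt]; first by rewrite big_nil coprimep1.
rewrite big_cons coprimepMr coprimep_XsubC pt ?mem_head//=.
by apply: IHt => u ut; apply: pt; rewrite in_cons ut orbT.
Qed.

(* The nonvanishing of all residues is what makes the fraction reduced. *)
Lemma random_rational_poles K t a : uniq t -> (forall v, v \in t -> ~ K v) ->
  (forall v, v \in t -> measurable_C (a v)) -> (forall v w, a v w != 0) ->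
  exists2 Rf, random_rational K Rf &
    forall w z, z \notin t -> Rf w z = \sum_(v <- t) a v w / (z - v).
Proof.
move=> ut tK ma aN0.
pose q : {poly CC R} := \prod_(v <- t) ('X - v%:P).
pose b v : {poly CC R} := \prod_(u <- t | u != v) ('X - u%:P).
pose p w : {poly CC R} := \sum_(v <- t) a v w *: b v.
(* For fixed z this is a combination of the residues with constant coefficients, also at a pole,
   where 1/0 = 0 makes them vanish. Measurability thus holds at every z. *)
have pE w z : (p w).[z] / q.[z] = \sum_(v <- t) ((b v).[z] / q.[z]) * a v w.
  rewrite horner_sum mulr_suml; apply: eq_bigr => v _.
  by rewrite hornerZ; ring.
have bN0 v : (b v).[v] != 0.
  rewrite horner_prod prodf_seq_neq0; apply/allP => u _; apply/implyP => uv.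
  by rewrite hornerXsubC subr_eq0 eq_sym.
exists (fun w z => (p w).[z] / q.[z]).
  split=> [w|z].
    exists (p w), q; split=> //.
    - by rewrite monic_neq0// monic_prod_XsubC.
    (* At the pole v every other [b u] has the factor X - v, so the numerator takes the value a_v *
       b_v(v), a product of nonzero numbers. *)
    - apply: coprimep_prod_XsubC => v vt; rewrite /root horner_sum (bigD1_seq v)//=.
      rewrite big1 ?addr0 => [|u uv]; first by rewrite hornerZ mulf_neq0.
      apply/eqP; rewrite hornerZ horner_prod mulf_eq0 prodf_seq_eq0; apply/orP; right.
      by apply/hasP; exists v => //; rewrite eq_sym uv hornerXsubC subrr eqxx.
    - move=> z Kz; rewrite root_prod_XsubC; apply/negP => /tK; exact.
  under eq_fun do rewrite pE.
  by apply: measurable_C_sum => v vt; apply: measurable_CZ; exact: ma.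
move=> w z zt; rewrite pE; apply: eq_big_seq => v vt.
have qE : q.[z] = (z - v) * (b v).[z].
  by rewrite /q horner_prod (bigD1_seq v)//= hornerXsubC horner_prod.
have : q.[z] != 0 by move: zt; rewrite -root_prod_XsubC.
by rewrite qE mulf_eq0 negb_or => /andP[zv bz]; field; rewrite zv bz.
Qed.

(** The quadrature list may repeat a node, whereas partial fractions need distinct poles: the
    weights at equal nodes are collected. *)
Lemma sum_by_node (s : seq (CC R * CC R)) (F : CC R * CC R -> CC R) :
  \sum_(xc <- s) F xc =
  \sum_(v <- undup (map fst s)) \sum_(xc <- s | xc.1 == v) F xc.
Proof.
rewrite (exchange_big_dep xpredT)//=; apply: eq_big_seq => xc xcs.
rewrite -big_filter (_ : seq.filter _ _ = [:: xc.1]) ?big_seq1//.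
rewrite -[RHS](@filter_pred1_uniq _ (undup (map fst s)))// ?undup_uniq//.
  by apply: eq_filter => v /=; rewrite eq_sym.
by rewrite mem_undup; apply: map_f.
Qed.

Lemma nrm_sum_le (I : eqType) (r : seq I) (F : I -> CC R) (c : R) :
  (forall i, i \in r -> nrm (F i) <= c) -> nrm (\sum_(i <- r) F i) <= (size r)%:R * c.
Proof.
elim: r => [_|i r IHr Fc]; first by rewrite big_nil nrm0 mul0r.
rewrite big_cons /= -natr1 mulrDl mul1r addrC; apply: le_trans (nrmD _ _) _.
apply: lerD; last by apply: Fc; rewrite mem_head.
by apply: IHr => j jr; apply: Fc; rewrite in_cons jr orbT.
Qed.

Lemma random_rational_quadrature (K : set (CC R)) (s : seq (CC R * CC R))
  (f : Omega -> CC R -> CC R) r e : 0 < r -> 0 < e ->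
  (forall xc, xc \in s -> forall z, K z -> r <= nrm (xc.1 - z)) ->
  (forall xc, xc \in s -> measurable_C (fun w => f w xc.1)) ->
  exists2 Rf, random_rational K Rf & forall w z, K z ->
    nrm (Rf w z - \sum_(xc <- s) xc.2 * (f w xc.1 / (xc.1 - z))) <= e.
Proof.
move=> r0 e0 sr mf; pose t := undup (map fst s).
(* The sign comes from 1/(x - z) = -1/(z - x). *)
pose a v w := \sum_(xc <- s | xc.1 == v) - xc.2 * f w xc.1.
pose n1 : R := (size t).+1%:R; have n10 : 0 < n1 by rewrite ltr0Sn.
(* Replacing a zero residue by eta changes its fraction by at most eta / r = e / n1 on K, and there
   are fewer than n1 poles. *)
pose eta : R := e * r / n1; have eta0 : 0 < eta by rewrite divr_gt0// mulr_gt0.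
pose a' v w := if a v w == 0 then cx eta 0 else a v w.
have tr v z : v \in t -> K z -> r <= nrm (z - v).
  rewrite mem_undup => /mapP[xc xcs ->] Kz; rewrite nrmB; exact: sr.
have ma v : measurable_C (a v).
  rewrite /a; under eq_fun do rewrite -big_filter.
  apply: measurable_C_sum => xc; rewrite mem_filter => /andP[_ xcs].
  by apply: measurable_CZ; exact: mf.
have etaN0 : cx eta 0 != 0 by rewrite -nrm_gt0 nrm_cx0 gtr0_norm.
have [||||Rf rR RfE] := @random_rational_poles K t a'.
- exact: undup_uniq.
- by move=> v vt /(tr v v vt); rewrite subrr nrm0; lra.
- by move=> v _; exact: measurable_C_if_eq0.
- by move=> v w; rewrite /a'; case: ifPn.
exists Rf => // w z Kz; rewrite RfE; last first.
  by apply/negP => zt; have := tr z z zt Kz; rewrite subrr nrm0; lra.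
rewrite sum_by_node -/t [X in _ - X](eq_bigr (fun v => a v w / (z - v))); last first.
  move=> v _; rewrite /a mulr_suml; apply: eq_bigr => xc /eqP ->.
  by rewrite -(opprB z v) invrN; ring.
rewrite -sumrB.
have : forall v, v \in t -> nrm (a' v w / (z - v) - a v w / (z - v)) <= e / n1.
  move=> v vt; have rz := tr v z vt Kz; have z0 : 0 < nrm (z - v) by exact: lt_le_trans rz.
  rewrite -mulrBl nrmM nrmV ler_pdivrMr//.
  apply: (@le_trans _ _ eta).
    rewrite /a'; case: eqVneq => [->|_]; first by rewrite subr0 nrm_cx0 gtr0_norm.
    by rewrite subrr nrm0 ltW.
  by rewrite /eta mulrAC ler_wpM2l// divr_ge0 ?ltW.
have : (size t)%:R * (e / n1) <= e.
  rewrite mulrCA ler_piMr ?(ltW e0)// ler_pdivrMr// mul1r ler_nat //.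
move=> te Ht; apply: le_trans te; exact: nrm_sum_le.
Qed.

End RandomRational.

(** * Choice of the random approximants *)

Unset Implicit Arguments.

Theorem theorem3p2 (d : measure_display) (Omega : measurableType d)
  (R : realType) (U : set (CC R)) (f : Omega -> CC R -> CC R)
  (K : set (CC R)) :
  open U -> random_holomorphic U f -> compact K -> K `<=` U ->
  exists Rs : nat -> Omega -> CC R -> CC R,
    (forall n, random_rational K (Rs n)) /\
    (forall w : Omega, unif_cvg_on K (fun n => Rs n w) (f w)).
Proof.
move=> oU [hf mf] cK KU.
have [s [[r r0 sr] Hs]] := runge_quadrature oU cK KU.
have approx n : exists Rf, random_rational K Rf /\ forall w z, K z ->
    nrm (Rf w z - \sum_(xc <- s n) xc.2 * (f w xc.1 / (xc.1 - z))) <= n.+1%:R^-1.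
  have n0 : 0 < n.+1%:R^-1 :> R by rewrite invr_gt0.
  have [||Rf rR RfE] := random_rational_quadrature (K := K) (s := s n) (f := f) r0 n0.
  - by move=> xc /sr[].
  - by move=> xc /sr[/mf].
  by exists Rf.
have [Rs HRs] := choice approx.
exists Rs; split=> [n|w e /gt0C[-> e0]]; first by have [] := HRs n.
have e2 : 0 < re e / 2 by rewrite divr_gt0.
(* The approximants were chosen before ω; only this rank depends on it. *)
have [N HN] := Hs _ (hf w) _ e2.
exists (N + Num.bound (re e / 2)^-1)%N => n nN z Kz; rewrite norm_ltC /=.
have := HN n (leq_trans (leq_addr _ _) nN) z Kz.
have [_ /(_ w z Kz)] := HRs n.
move=> Rs_near S_near; apply: le_lt_trans (nrm_triangle _ _ _) _.
rewrite [ltRHS]splitr; apply: ltr_leD S_near; apply: le_lt_trans Rs_near _.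
rewrite -[ltRHS]invrK ltf_pV2 ?posrE ?invr_gt0//.
apply: lt_le_trans (archi_boundP _) _; first by rewrite invr_ge0 ltW.
by rewrite ler_nat leqW// (leq_trans (leq_addl _ _) nN).
Qed.
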